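(* Let $p$ be an odd prime, $G=\operatorname{Qd}(p)=(\mathbb Z/p\times\mathbb Z/p)\rtimes SL_2(p)$, $R=\mathbb Z/p$, and let $\mathcal F$ be the family of all subgroups $H\le G$ such that $\operatorname{rank}_p(H)\le1$. Let $\underline n\colon\mathcal S(G)\to\mathbb Z$ be a conjugation-invariant function (supported on $\mathcal F$) with $\underline n(1)\ge0$. Then there exists no finite projective chain complex $\mathbf C$ over $R\Gamma_G$ which is an $R$-homology $\underline n$-sphere.
   Context: In $\operatorname{Qd}(p)$, $SL_2(p)=SL_2(\mathbb F_p)$ acts on $\mathbb Z/p\times\mathbb Z/p=\mathbb F_p^2$ in the natural way. $\operatorname{rank}_p(H)$ is the largest $k$ with $(\mathbb Z/p)^k\le H$. $\mathcal S(G)$ is the set of all subgroups of $G$; $\underline n$ is supported on $\mathcal F$ if $\underline n(H)=-1$ for $H\notin\mathcal F$. $\Gamma_G=\operatorname{Or}_{\mathcal F}G$ is the orbit category: objects are the orbits $G/K$ with $K\in\mathcal F$, morphisms are $G$-maps. An $R\Gamma_G$-module is a contravariant functor $M$ from $\Gamma_G$ to $R$-modules; write $M(K)=M(G/K)$. For $H\in\mathcal F$, $R[G/H^{?}]$ is the module $K\mapsto R[(G/H)^K]$; free modules are direct sums of such, projective modules are the direct summands of free ones. Chain complexes $\mathbf C$ are non-negative; $\mathbf C$ is finite if $\mathbf C_i=0$ for all large $i$ and every $\mathbf C_i$ is finitely generated; projective if every $\mathbf C_i$ is. $\underline R$ is the constant functor with value $R$. An augmentation of $\mathbf C$ is a map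 $\varepsilon\colon\mathbf C_0\to\underline R$ with $\varepsilon\circ\partial_1=0$ such that $\varepsilon(H)$ is surjective whenever $\mathbf C(H)\ne0$; reduced homology is the homology of the augmented complex with $\underline R$ in degree $-1$. $\mathbf C$ is an $R$-homology $\underline n$-sphere if it has an augmentation such that for every $K\in\mathcal F$ the reduced homology of $\mathbf C(K)$ is that of an $\underline n(K)$-sphere with coefficients in $R$ (i.e. $R$ in degree $\underline n(K)\ge-1$ and zero otherwise; $S^{-1}=\emptyset$). *)

(* Defs.v *)
From HB Require Import structures.
From mathcomp Require Import all_boot all_order all_algebra all_fingroup.
From mathcomp Require Import all_solvable all_character.
From mathcomp Require Import boolp.

Set Implicit Arguments.
Unset Strict Implicit.
Unset Printing Implicit Defensive.

Import GRing.Theory.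

Local Open Scope ring_scope.

Section Qd.
Variable p : nat.

Definition SL2 : {set {'GL_2['F_p]}} :=
  [set A : {'GL_2['F_p]} | \det (GLval A) == 1].

Fact SL2_group_set : group_set SL2.
Proof.
apply/group_setP; split=> [|A B]; first by rewrite inE det1.
by rewrite !inE => /eqP dA /eqP dB; rewrite -[GLval _]/(GLval A *m GLval B)
  det_mulmx dA dB mulr1.
Qed.
Canonical SL2_group := Group SL2_group_set.

Definition SL2_natural : mx_representation 'F_p SL2_group 2 :=
  subg_repr (GLrepr 'F_p 1) (subsetT SL2_group).

(* The library's actions are right actions, so A acts on the row vector v by
   v *m A. Composing with the automorphism A |-> A^-T of SL2 and transposing
   vectors turns this into the left action of SL2 on column vectors, hence the
   two conventions give isomorphic semidirect products. *)
Definition Qd : finGroupType :=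
  sdprod_groupType ('MR SL2_natural)%gact.

End Qd.

Definition rank_le1_family (gT : finGroupType) (p : nat) : {set {group gT}} :=
  [set H : {group gT} | ('r_p(H)%g <= 1)%N].

Section Orbits.
Variable gT : finGroupType.
Implicit Types K L M : {group gT}.

(* G is the full group [set: gT], and orb K is the orbit G/K of left cosets. *)
Definition orb K := {A : {set gT} | A \in lcosets K [set: gT]}.

Fact orb_act_subproof K (g : gT) (x : orb K) :
  (g *: val x)%g \in lcosets K [set: gT].
Proof.
case: x => /= A /lcosetsP[a _ ->].
by apply/lcosetsP; exists (g * a)%g; rewrite ?inE // lcosetM.
Qed.
Definition orb_act K g (x : orb K) : orb K :=
  exist _ (g *: val x)%g (orb_act_subproof g x).

Fact orb_base_subproof K : (K : {set gT}) \in lcosets K [set: gT].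
Proof. by apply/lcosetsP; exists 1%g; rewrite ?inE // lcoset1. Qed.
Definition orb_base K : orb K := exist _ (K : {set gT}) (orb_base_subproof K).

Lemma orb_act1 K (x : orb K) : orb_act 1%g x = x.
Proof. by apply: val_inj; rewrite /= lcoset1. Qed.

Lemma orb_actM K g h (x : orb K) :
  orb_act (g * h)%g x = orb_act g (orb_act h x).
Proof. by apply: val_inj; rewrite /= lcosetM. Qed.

Record gmap K L := GMap {
  gmap_fun :> {ffun orb K -> orb L};
  gmap_equivariant :
    [forall g : gT, forall x, gmap_fun (orb_act g x) == orb_act g (gmap_fun x)]
}.

Lemma gmapJ K L (f : gmap K L) g x : f (orb_act g x) = orb_act g (f x).
Proof. by have /forallP/(_ g)/forallP/(_ x)/eqP := gmap_equivariant f. Qed.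

Fact gmap_id_subproof K : [forall g : gT, forall x : orb K,
  [ffun y : orb K => y] (orb_act g x) == orb_act g ([ffun y : orb K => y] x)].
Proof. by apply/forallP=> g; apply/forallP=> x; rewrite !ffunE. Qed.
Definition gmap_id K : gmap K K := GMap (gmap_id_subproof K).

Fact gmap_comp_subproof K L M (f : gmap L M) (h : gmap K L) :
  [forall g : gT, forall x : orb K,
    [ffun y => f (h y)] (orb_act g x) == orb_act g ([ffun y => f (h y)] x)].
Proof. by apply/forallP=> g; apply/forallP=> x; rewrite !ffunE !gmapJ. Qed.
Definition gmap_comp K L M (f : gmap L M) (h : gmap K L) : gmap K M :=
  GMap (gmap_comp_subproof f h).

Definition orb_fix H K :=
  {x : orb H | [forall k in K, orb_act k x == x]}.

(* A G-map f : G/K -> G/L is determined by the coset f(K) = aL, and it induces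
   (G/H)^L -> (G/H)^K, x |-> ax; the result does not depend on the choice of a
   in aL because x is fixed by L. *)
Definition gmap_rep K L (f : gmap K L) : gT := repr (val (f (orb_base K))).

Lemma orb_rep L (y : orb L) : val y = (repr (val y) *: L)%g.
Proof.
case: y => /= A /lcosetsP[a _ ->]; set b := repr _.
by apply/esym/lcoset_eqP; apply: (mem_repr a); apply: lcoset_refl.
Qed.

Lemma gmap_repE K L (f : gmap K L) :
  f (orb_base K) = orb_act (gmap_rep f) (orb_base L).
Proof. by apply: val_inj; rewrite /= -orb_rep. Qed.

Lemma orb_fixP H K (x : orb_fix H K) k : k \in K -> orb_act k (val x) = val x.
Proof. by move=> Kk; have /forallP/(_ k)/implyP/(_ Kk)/eqP := valP x. Qed.

Lemma orb_act_indep H L (x : orb_fix H L) a b :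
  orb_act a (orb_base L) = orb_act b (orb_base L) ->
  orb_act a (val x) = orb_act b (val x).
Proof.
move=> /(congr1 val) /= eq_ab.
have Lab : (b^-1 * a)%g \in L.
  by rewrite -mem_lcoset -eq_ab lcoset_refl.
by rewrite -{1}[a](mulKVg b) orb_actM (orb_fixP x Lab).
Qed.

Fact fix_map_subproof H K L (f : gmap K L) (x : orb_fix H L) :
  [forall k in K,
    orb_act k (orb_act (gmap_rep f) (val x)) == orb_act (gmap_rep f) (val x)].
Proof.
apply/forallP=> k; apply/implyP=> Kk; apply/eqP; rewrite -orb_actM.
apply: orb_act_indep; rewrite orb_actM -!gmap_repE -gmapJ; congr (f _).
by apply: val_inj; rewrite /= lcoset_id.
Qed.
Definition fix_map H K L (f : gmap K L) (x : orb_fix H L) : orb_fix H K :=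
  exist _ (orb_act (gmap_rep f) (val x)) (fix_map_subproof f x).

Lemma fix_map_id H K (x : orb_fix H K) : fix_map (gmap_id K) x = x.
Proof.
apply: val_inj; rewrite /= -[RHS]orb_act1; apply: orb_act_indep.
by rewrite -gmap_repE /= ffunE orb_act1.
Qed.

Lemma fix_map_comp H K L M (f : gmap L M) (h : gmap K L) (x : orb_fix H M) :
  fix_map (gmap_comp f h) x = fix_map h (fix_map f x).
Proof.
apply: val_inj; rewrite /= -orb_actM; apply: orb_act_indep.
by rewrite -gmap_repE /= ffunE gmap_repE gmapJ gmap_repE orb_actM.
Qed.

End Orbits.

Section Pushforward.
Variables (R : comNzRingType) (X Y Z : finType).

Definition pushf (phi : X -> Y) (c : {ffun X -> R^o}) : {ffun Y -> R^o} :=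
  [ffun y => \sum_(x | phi x == y) c x].

Fact pushf_is_linear phi : linear (pushf phi).
Proof.
move=> a c d; apply/ffunP=> y; rewrite !ffunE scaler_sumr -big_split /=.
by apply: eq_bigr => x _; rewrite !ffunE.
Qed.
HB.instance Definition _ phi :=
  GRing.isLinear.Build R {ffun X -> R^o} {ffun Y -> R^o} _ (pushf phi)
    (pushf_is_linear phi).

End Pushforward.

Lemma pushf_id (R : comNzRingType) (X : finType) (phi : X -> X)
  (c : {ffun X -> R^o}) : phi =1 id -> pushf phi c = c.
Proof.
move=> phiE; apply/ffunP=> x; rewrite ffunE (eq_bigl (pred1 x)) ?big_pred1_eq //.
by move=> y; rewrite /= phiE.
Qed.

Lemma pushf_comp (R : comNzRingType) (X Y Z : finType) (phi : Y -> Z)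
    (psi : X -> Y) (chi : X -> Z) (c : {ffun X -> R^o}) :
  chi =1 phi \o psi -> pushf chi c = pushf phi (pushf psi c).
Proof.
move=> chiE; apply/ffunP=> z; rewrite !ffunE.
rewrite (partition_big psi (fun y => phi y == z)) /=; last first.
  by move=> x; rewrite chiE.
apply: eq_bigr => y /eqP phiy; rewrite ffunE; apply: eq_bigl => x.
by rewrite chiE /=; case: (psi x =P y) => [->|]; rewrite ?andbF ?phiy ?eqxx.
Qed.

Section OrbitModules.
Variables (gT : finGroupType) (F : {set {group gT}}) (R : comNzRingType).

Definition orb_ob := {K : {group gT} | K \in F}.
Definition orb_mor (K L : orb_ob) := gmap (val K) (val L).

Record rgmod := RGMod {
  rg_ob :> orb_ob -> lmodType R;
  rg_map : forall K L, orb_mor K L -> {linear rg_ob L -> rg_ob K};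
  rg_map_id : forall K x, rg_map (gmap_id (val K) : orb_mor K K) x = x;
  rg_map_comp : forall K L M (f : orb_mor L M) (h : orb_mor K L) x,
    rg_map (gmap_comp f h : orb_mor K M) x = rg_map h (rg_map f x)
}.

Record rghom (M N : rgmod) := RGHom {
  rg_fun :> forall K, {linear M K -> N K};
  rg_natural : forall K L (f : orb_mor K L) x,
    rg_fun K (rg_map M f x) = rg_map N f (rg_fun L x)
}.

Section OrbitModule.
Variable H : orb_ob.

Definition orbmod_ob (K : orb_ob) : lmodType R :=
  {ffun orb_fix (val H) (val K) -> R^o}.
Definition orbmod_map (K L : orb_ob) (f : orb_mor K L) :
  {linear orbmod_ob L -> orbmod_ob K} := pushf (@fix_map _ (val H) _ _ f).

Fact orbmod_map_id K x : orbmod_map (gmap_id (val K) : orb_mor K K) x = x.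
Proof. by apply: pushf_id => y; rewrite fix_map_id. Qed.

Fact orbmod_map_comp K L M (f : orb_mor L M) (h : orb_mor K L) x :
  orbmod_map (gmap_comp f h : orb_mor K M) x = orbmod_map h (orbmod_map f x).
Proof. by apply: pushf_comp => y; rewrite fix_map_comp. Qed.

(* R[G/H^?], whose value at K is R[(G/H)^K]. *)
Definition orbmod : rgmod := RGMod orbmod_map_id orbmod_map_comp.

End OrbitModule.

Section ConstantModule.
Definition const_ob (K : orb_ob) : lmodType R := R^o.
Definition const_map (K L : orb_ob) (f : orb_mor K L) :
  {linear const_ob L -> const_ob K} := @idfun R^o.

Definition constmod : rgmod :=
  @RGMod const_ob const_map (fun _ _ => erefl) (fun _ _ _ _ _ _ => erefl).
End ConstantModule.

Section BinarySum.
Variables M N : rgmod.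

Definition dsum2_ob (K : orb_ob) : lmodType R := (M K * N K)%type.
Definition dsum2_fun (K L : orb_ob) (f : orb_mor K L) (u : dsum2_ob L) :
  dsum2_ob K := (rg_map M f u.1, rg_map N f u.2).

Fact dsum2_fun_is_linear K L (f : orb_mor K L) : linear (dsum2_fun f).
Proof. by move=> a u v; rewrite /dsum2_fun !linearP. Qed.
HB.instance Definition _ K L (f : orb_mor K L) :=
  GRing.isLinear.Build R (dsum2_ob L) (dsum2_ob K) _ (dsum2_fun f)
    (dsum2_fun_is_linear f).
Definition dsum2_map (K L : orb_ob) (f : orb_mor K L) :
  {linear dsum2_ob L -> dsum2_ob K} := dsum2_fun f.

Fact dsum2_map_id K x : dsum2_map (gmap_id (val K) : orb_mor K K) x = x.
Proof. by case: x => a b; congr pair; apply: rg_map_id. Qed.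

Fact dsum2_map_comp K L P (f : orb_mor L P) (h : orb_mor K L) x :
  dsum2_map (gmap_comp f h : orb_mor K P) x = dsum2_map h (dsum2_map f x).
Proof. by congr pair; apply: rg_map_comp. Qed.

Definition dsum2 : rgmod := RGMod dsum2_map_id dsum2_map_comp.

End BinarySum.

(* M is the direct sum of the A i, with inclusions iota i: every element of
   every M K is in a unique way a finite sum of elements coming from the A i. *)
Definition is_direct_sum (I : eqType) (A : I -> rgmod) (M : rgmod)
    (iota : forall i, rghom (A i) M) : Prop :=
  forall K : orb_ob,
    (forall x : M K, exists (s : seq I) (a : forall i, A i K),
       uniq s /\ x = \sum_(i <- s) iota i K (a i)) /\
    (forall (s : seq I) (a : forall i, A i K),
       uniq s -> \sum_(i <- s) iota i K (a i) = 0 ->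
       forall i, i \in s -> a i = 0).

Definition is_free_on (I : eqType) (H : I -> orb_ob) (M : rgmod) : Prop :=
  exists iota : forall i, rghom (orbmod (H i)) M, is_direct_sum iota.

Definition is_free (M : rgmod) : Prop :=
  exists (I : eqType) (H : I -> orb_ob), is_free_on H M.

Definition is_projective (M : rgmod) : Prop :=
  exists N : rgmod, is_free (dsum2 M N).

Definition is_finitely_generated (M : rgmod) : Prop :=
  exists (I : finType) (H : I -> orb_ob) (E : rgmod) (q : rghom E M),
    is_free_on H E /\ forall K (y : M K), exists x : E K, q K x = y.

Record chain_complex := ChainComplex {
  ch_ob :> nat -> rgmod;
  ch_d : forall i, rghom (ch_ob i.+1) (ch_ob i);
  ch_dd : forall i K x, ch_d i K (ch_d i.+1 K x) = 0
}.

Definition is_finite_complex (C : chain_complex) : Prop :=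
  (exists N : nat, forall i, (N <= i)%N -> forall K (x : C i K), x = 0) /\
  (forall i, is_finitely_generated (C i)).

Definition is_projective_complex (C : chain_complex) : Prop :=
  forall i, is_projective (C i).

Definition is_augmentation (C : chain_complex) (eps : rghom (C 0%N) constmod) :
    Prop :=
  (forall K (x : C 1%N K), eps K (ch_d C 0 K x) = 0) /\
  (forall K, (exists i (x : C i K), x <> 0) ->
     forall r : R, exists x : C 0%N K, eps K x = r).

End OrbitModules.

Section QuotientModule.
Variables (R : pzRingType) (V : lmodType R) (S : zmodClosed V).
Hypothesis SZ : forall (a : R) v, v \in S -> a *: v \in S.
Local Open Scope quotient_scope.

Definition quotmod of (forall (a : R) v, v \in S -> a *: v \in S) :=
  Quotient.quot S.
Local Notation Q := (quotmod SZ).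
HB.instance Definition _ := GRing.Zmodule.on Q.
HB.instance Definition _ := Quotient.on Q.

Definition quotmod_scale (a : R) (x : Q) : Q :=
  \pi_Q (a *: generic_quotient.repr x).

Lemma quotmod_piZ a (v : V) :
  \pi_Q (a *: v) = quotmod_scale a (\pi_Q v).
Proof.
apply/eqP; rewrite -Quotient.idealrBE -scalerBr SZ //.
by rewrite Quotient.idealrBE reprK.
Qed.

Lemma quotmod_piD (u v : V) :
  \pi_Q (u + v) = \pi_Q u + \pi_Q v.
Proof. by rewrite [LHS]Quotient.pi_add. Qed.

Fact quotmod_scaleA a b x :
  quotmod_scale a (quotmod_scale b x) = quotmod_scale (a * b) x.
Proof.
by elim/quotW: x => v; rewrite -[quotmod_scale b _]quotmod_piZ -!quotmod_piZ scalerA.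
Qed.

Fact quotmod_scale1 : left_id 1 quotmod_scale.
Proof. by elim/quotW=> v; rewrite -quotmod_piZ scale1r. Qed.

Fact quotmod_scaleDr : right_distributive quotmod_scale +%R.
Proof.
move=> a; elim/quotW=> x; elim/quotW=> y; rewrite -quotmod_piD -!quotmod_piZ.
by rewrite scalerDr quotmod_piD.
Qed.

Fact quotmod_scaleDl x : {morph quotmod_scale^~ x : a b / a + b}.
Proof.
by elim/quotW: x => x a b; rewrite /= -!quotmod_piZ scalerDl quotmod_piD.
Qed.

HB.instance Definition _ := GRing.Zmodule_isLmodule.Build R Q
  quotmod_scaleA quotmod_scale1 quotmod_scaleDr quotmod_scaleDl.

End QuotientModule.

Section Homology.
Variables (R : pzRingType) (U V W : lmodType R).
Variables (f : {linear U -> V}) (g : {linear V -> W}).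

Definition cycle_pred : {pred V} := fun v => g v == 0.

Fact cycle_pred_submod : submod_closed cycle_pred.
Proof.
split=> [|a u v]; rewrite !unfold_in ?linear0 // => /eqP u0 /eqP v0.
by rewrite linearP u0 v0 scaler0 addr0.
Qed.
HB.instance Definition _ :=
  GRing.isSubmodClosed.Build R V cycle_pred cycle_pred_submod.

Definition cycle_mod := {v : V | v \in cycle_pred}.
HB.instance Definition _ := SubChoice.on cycle_mod.
HB.instance Definition _ := [SubChoice_isSubLmodule of cycle_mod by <:].

Definition boundary_pred : {pred cycle_mod} :=
  fun z => `[< exists u, f u = val z >].

Fact boundary_pred_submod : submod_closed boundary_pred.
Proof.
split=> [|a u v]; rewrite !unfold_in.
  by apply/asboolP; exists 0; rewrite !linear0.
move=> /asboolP[x fx] /asboolP[y fy]; apply/asboolP; exists (a *: x + y).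
by rewrite !linearP fx fy.
Qed.
HB.instance Definition _ :=
  GRing.isSubmodClosed.Build R cycle_mod boundary_pred boundary_pred_submod.

Fact boundary_pred_scale (a : R) z :
  z \in boundary_pred -> a *: z \in boundary_pred.
Proof. exact: rpredZ. Qed.

(* ker g / (im f :&: ker g); it is only used when g \o f = 0. *)
Definition homology : lmodType R := quotmod boundary_pred_scale.

End Homology.

Section Spheres.
Variables (gT : finGroupType) (F : {set {group gT}}) (R : comNzRingType).

(* The homology in degree k - 1 of the complex
   ... -> C_1(K) -> C_0(K) -> R -> 0 with R in degree -1. *)
Definition reduced_homology (C : chain_complex F R)
    (eps : rghom (C 0%N) (constmod F R)) (K : orb_ob F) (k : nat) : lmodType R :=
  match k with
  | 0%N => homology (eps K) (\0 : {linear R^o -> R^o})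
  | 1%N => homology (ch_d C 0 K) (eps K)
  | i.+2 => homology (ch_d C i.+1 K) (ch_d C i K)
  end.

Definition is_homology_sphere (n : {group gT} -> int) (C : chain_complex F R) :
    Prop :=
  exists eps : rghom (C 0%N) (constmod F R),
    is_augmentation eps /\
    forall K : orb_ob F, -1 <= n (val K) /\
      forall k : nat,
        if k%:Z - 1 == n (val K)
        then exists h : {linear reduced_homology eps K k -> R^o}, bijective h
        else forall x : reduced_homology eps K k, x = 0.

End Spheres.

(* Main.v *)
From HB Require Import structures.
Require Import Defs.
From mathcomp Require Import all_boot all_order all_algebra all_fingroup.
From mathcomp Require Import all_solvable all_character.
From mathcomp Require Import boolp zify ring.

Set Implicit Arguments.
Unset Strict Implicit.
Unset Printing Implicit Defensive.

Import Order.TTheory GRing.Theory Num.Theory.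
Local Open Scope ring_scope.

(** Each z <> 1 in V = (Z/p)^2 is central in a subgroup P of G of order p^3
    which, p being odd, has exponent p. An element of P outside <z> fixing a
    point of (G/K)^<z> would, with z, generate a subgroup of rank 2 of a
    conjugate of K; hence P/<z> = (Z/p)^2 acts freely on these sets, and
    C(<z>) is a complex of free (Z/p)^2-modules. A finite complex of free
    (Z/p)^2-modules never has the homology of a sphere of dimension >= 0,
    because dim H_j((Z/p)^2; F_p) = j + 1 is not periodic in j. Therefore
    n(<z>) = -1 and C(<z>) = 0. Now a map R[G/K^?] -> C_i factors on each point
    of G/K fixed by some z through C_i(<z>) = 0, so C(1) is free over V, and
    the same obstruction contradicts n(1) >= 0. *)

(* For k[X, Y]/(X^p, Y^p), with e = p - 1, the degree j part of the tensor
   product of the two periodic resolutions is a sum of copies of V indexed by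
   a + b = j. A chain is represented by c : nat -> nat -> V, of which only the
   values c a b with a + b = j are relevant. *)
Section Koszul.
Variables (k : fieldType) (e : nat).

(** * The tensor product of the two periodic resolutions *)

Section Operators.
Variable V : lmodType k.
Implicit Types X Y : {linear V -> V}.

(** The differential leaving degree [a] > 0 of the periodic resolution over $k[X]/(X^{e+1})$, with
    coefficients in [V]. *)
Definition kop X (a : nat) (v : V) := if odd a then X v else iter e X v.

Lemma iter_linear X n : linear (iter n X).
Proof. by elim: n => // n IHn r u v; rewrite /= IHn linearP. Qed.

HB.instance Definition _ X n :=
  GRing.isLinear.Build k V V _ (iter n X) (iter_linear X n).

Fact kop_is_linear X a : linear (kop X a).
Proof. by move=> r u v; rewrite /kop; case: ifP => _; rewrite linearP. Qed.
HB.instance Definition _ X a :=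
  GRing.isLinear.Build k V V _ (kop X a) (kop_is_linear X a).

(** Component in bidegree (a, b) of the total differential; the sign makes the mixed terms of its
    square cancel. *)
Definition kbd X Y (c : nat -> nat -> V) a b : V :=
  kop X a.+1 (c a.+1 b) + (-1) ^+ a *: kop Y b.+1 (c a b.+1).

Lemma iter_comm X Y m n : (forall v, X (Y v) = Y (X v)) ->
  forall v, iter m X (iter n Y v) = iter n Y (iter m X v).
Proof.
move=> XY; have XiY v : X (iter n Y v) = iter n Y (X v).
  by elim: n => //= n <-; rewrite XY.
by elim: m => //= m IHm v; rewrite IHm XiY.
Qed.

Lemma kop_comm X Y a b : (forall v, X (Y v) = Y (X v)) ->
  forall v, kop X a (kop Y b v) = kop Y b (kop X a v).
Proof.
move=> XY v; rewrite /kop; case: ifP => _; case: ifP => _; first exact: XY.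
- exact: (@iter_comm X Y 1).
- exact: (@iter_comm X Y _ 1).
- exact: iter_comm.
Qed.

Lemma kopSK X a v : (forall u, iter e.+1 X u = 0) -> kop X a (kop X a.+1 v) = 0.
Proof.
move=> Xn; rewrite /kop /=; case: (odd a) => /=; first by rewrite -[RHS](Xn v).
by rewrite -iterSr Xn.
Qed.

Lemma kbdK X Y c a b : (forall v, X (Y v) = Y (X v)) ->
  (forall u, iter e.+1 X u = 0) -> (forall u, iter e.+1 Y u = 0) ->
  kbd X Y (kbd X Y c) a b = 0.
Proof.
move=> XY Xn Yn; rewrite /kbd !linearD /= !linearZ /= !kopSK // !(scaler0, add0r, addr0).
by rewrite (kop_comm _ _ XY) exprS mulN1r scaleNr addrC subrr.
Qed.

Lemma eq_kbd X Y c c' j : (forall a b, (a + b = j.+1)%N -> c a b = c' a b) ->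
  forall a b, (a + b = j)%N -> kbd X Y c a b = kbd X Y c' a b.
Proof. by move=> cc a b ab; rewrite /kbd !cc ?addSn ?addnS ?ab. Qed.

Lemma kbdB X Y c c' a b :
  kbd X Y (fun a b => c a b - c' a b) a b = kbd X Y c a b - kbd X Y c' a b.
Proof. by rewrite /kbd !linearB /= opprD addrACA. Qed.

Lemma kbdD X Y c c' a b :
  kbd X Y (fun a b => c a b + c' a b) a b = kbd X Y c a b + kbd X Y c' a b.
Proof. by rewrite /kbd !linearD /= addrACA. Qed.

Lemma kbd_sum X Y (I : finType) (l : I -> k) (c : I -> nat -> nat -> V) a b :
  kbd X Y (fun a b => \sum_i l i *: c i a b) a b = \sum_i l i *: kbd X Y (c i) a b.
Proof.
rewrite /kbd !linear_sum /= -big_split /=; apply: eq_bigr => i _.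
by rewrite !linearZ /= scalerDr !scalerA mulrC.
Qed.

(* Over k[X, Y]/(X^p, Y^p) this characterises free modules: the kernel of the
   socle generator is the radical. *)
Definition free_like X Y :=
  forall v, iter e X (iter e Y v) = 0 -> exists u w, v = X u + Y w.

(** * Exactness on free modules *)

Section Exactness.
Variables X Y : {linear V -> V}.
Hypotheses (XY : forall v, X (Y v) = Y (X v)) (e_gt0 : (0 < e)%N).
Hypotheses (Xn : forall u, iter e.+1 X u = 0) (Yn : forall u, iter e.+1 Y u = 0).
Hypothesis freeV : free_like X Y.

Let X_iterY i v : X (iter i Y v) = iter i Y (X v).
Proof. exact: (@iter_comm X Y 1). Qed.

(** If $v = Xu + Y^i w$, then $X^e v = 0$ gives $X^e Y^i w = 0$, so $X^e Y^e w = 0$ and freeness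
    splits $w$ once more. At $i = e+1$ the second term vanishes. *)
Lemma free_like_kerX v : iter e X v = 0 -> exists u, v = X u.
Proof.
move=> Xv.
suff H i : (i <= e.+1)%N -> exists u w, v = X u + iter i Y w.
  by have [u [w ->]] := H _ (leqnn _); exists u; rewrite Yn addr0.
elim: i => [|i IHi] le_i; first by exists 0, v; rewrite linear0 add0r.
have [u [w def_v]] := IHi (ltnW le_i).
have Xw : iter e X (iter i Y w) = 0.
  by move: Xv; rewrite def_v linearD /= -iterSr Xn add0r.
have [|u' [w' def_w]] := freeV (v := w).
  rewrite iter_comm // in Xw; rewrite iter_comm //.
  by rewrite -[X in iter X Y](subnK (_ : (i <= e)%N)) // iterD Xw linear0.
exists (u + iter i Y u'), w'.
by rewrite def_v {1}def_w !linearD /= -iterSr addrA X_iterY.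
Qed.

Lemma free_like_kopX a v : (0 < a)%N -> kop X a v = 0 -> exists u, v = kop X a.+1 u.
Proof.
case: a => // a _; rewrite /kop /=; case: (boolP (odd a)) => _ /=; last first.
  move=> Xv.
  suff H i : (i <= e)%N -> exists u, v = iter i X u by exact: H.
  elim: i => [|i IHi] le_i; first by exists v.
  have [u def_v] := IHi (ltnW le_i).
  have [|w def_u] := free_like_kerX (v := u).
    by rewrite -(subnK le_i) iterD /= -def_v Xv linear0.
  by exists w; rewrite def_v def_u -iterSr.
exact: free_like_kerX.
Qed.

(** $V/XV$ is free over $k[Y]/(Y^{e+1})$, so the periodic complex in $Y$ is exact on it in positive
    degrees. *)
Lemma free_like_kopXY b u v : (0 < b)%N -> kop Y b v = X u ->
  exists u' w, v = X u' + kop Y b.+1 w.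
Proof.
(* Here $X^e Y^e w$ lies in $Y^{e-i} X^{e+1} V = 0$, so freeness applies to $w$. *)
have NX i w u' : (i <= e)%N -> iter i Y w = X u' -> exists u'' w', w = X u'' + Y w'.
  move=> le_i Yw; apply: freeV.
  have ->: iter e Y w = iter (e - i) Y (X u') by rewrite -Yw -iterD subnK.
  by rewrite -X_iterY -iterSr Xn.
case: b => // b _; rewrite /kop /=; case: (boolP (odd b)) => _ /= Yv; first exact: NX Yv.
suff H i : (i <= e)%N -> exists u' w, v = X u' + iter i Y w by exact: H.
elim: i => [|i IHi] le_i; first by exists 0, v; rewrite linear0 add0r.
have [u1 [w def_v]] := IHi (ltnW le_i).
have [|u2 [w2 def_w]] := NX i.+1 w (u - Y u1) le_i.
  by rewrite linearB /= -Yv def_v linearD /= XY addrC addKr.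
exists (u1 + iter i Y u2), w2.
by rewrite def_v {1}def_w !linearD /= -iterSr addrA X_iterY.
Qed.

(** Chains of degree $j+1$ occupy the columns $a = 0, \dots, j+1$. The induction is on the number
    [i] of highest columns that support the cycle: subtracting a boundary clears the lowest of
    them. *)
Lemma kbd_exact j c :
  (forall a b, (a + b = j)%N -> kbd X Y c a b = 0) ->
  exists f, forall a b, (a + b = j.+1)%N -> c a b = kbd X Y f a b.
Proof.
suff H i : (i <= j.+2)%N -> forall c, (forall a b, (a + b = j)%N -> kbd X Y c a b = 0) ->
    (forall a b, (a + b = j.+1)%N -> (a < j.+2 - i)%N -> c a b = 0) ->
    exists f, forall a b, (a + b = j.+1)%N -> c a b = kbd X Y f a b.
  by move=> cyc; apply: (H j.+2) => // a b _; rewrite subnn.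
elim: i => [|i IHi] le_i {}c cyc c0.
  exists (fun _ _ => 0) => a b ab; rewrite c0 //; last by lia.
  by rewrite /kbd !linear0 addr0.
have step f : (forall a b, (a + b = j.+1)%N -> (a < j.+2 - i)%N ->
    c a b = kbd X Y f a b) ->
    exists f, forall a b, (a + b = j.+1)%N -> c a b = kbd X Y f a b.
  move=> cf; have [||f' def_f'] := IHi (ltnW le_i) (fun a b => c a b - kbd X Y f a b).
  - by move=> a b ab; rewrite kbdB cyc // kbdK // subr0.
  - by move=> a b ab lt_a; rewrite cf ?subrr.
  exists (fun a b => f a b + f' a b) => a b ab.
  by rewrite kbdD -def_f' // addrC subrK.
set a0 := (j.+1 - i)%N; have a0E : (a0 + i = j.+1)%N by rewrite /a0; lia.
have c0' a b : (a + b = j.+1)%N -> (a < a0)%N -> c a b = 0.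
  by move=> ab lt_a; apply: c0 => //; rewrite /a0 in lt_a; lia.
(* In column 0 the complex in $X$ need not be exact. The cycle equation at (0, j) puts the
   $Y$-differential of [c 0 i] in the image of $X$, and exactness modulo that image yields both
   neighbours. *)
have [def_a0|a0_gt0] := posnP a0.
  have def_i : i = j.+1 by lia.
  have [||u' [w def_c]] := free_like_kopXY (b := i) (u := - c 1%N j) (v := c 0%N i).
  - by rewrite def_i.
  - move: (cyc 0%N j erefl); rewrite /kbd expr0 scale1r -def_i {1}/kop /= => /eqP.
    by rewrite linearN addrC addr_eq0 => /eqP.
  apply: (step (fun a b => if a is 0 then w else u')) => a b ab lt_a.
  have -> : a = 0%N by lia.
  have -> : b = i by lia.
  by rewrite def_c /kbd expr0 scale1r.
(* Column [a0 - 1] vanishes, so the cycle equation there says that the $X$-differential kills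
   [c a0 i]. *)
have [||u def_c] := free_like_kopX (a := a0) (v := c a0 i) => //.
  move: (cyc a0.-1 i ltac:(lia)); rewrite /kbd prednK //.
  by rewrite (c0' a0.-1) ?linear0 ?scaler0 ?addr0 //; lia.
apply: (step (fun a b => if (a == a0.+1) then u else 0)) => a b ab lt_a.
have [aE|ne_a] := eqVneq a a0.
  have -> : b = i by lia.
  by rewrite aE def_c /kbd eqxx ltn_eqF // !linear0 addr0.
rewrite c0' //; last by lia.
rewrite /kbd !ifN ?linear0 ?scaler0 ?addr0 //; lia.
Qed.
End Exactness.
End Operators.

(** * Lower bounds for Tor and dimension shifting *)

(** For a submodule [S], this says $\dim \operatorname{Tor}_j(k, S) \ge s$ over
    $k[X,Y]/(X^{e+1},Y^{e+1})$ without forming the homology. In degree 0 the cycle condition is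
    empty. *)
Definition indep_classes (V : lmodType k) (X Y : {linear V -> V}) (S : V -> Prop) j s :=
  exists c : 'I_s -> nat -> nat -> V,
    [/\ forall i a b, (a + b)%N = j -> S (c i a b),
        forall i a b, (a + b).+1 = j -> kbd X Y (c i) a b = 0
      & forall (l : 'I_s -> k) f, (forall a b, (a + b)%N = j.+1 -> S (f a b)) ->
          (forall a b, (a + b)%N = j -> \sum_i l i *: c i a b = kbd X Y f a b) ->
        forall i, l i = 0].

Lemma kbd_map (V W : lmodType k) (X Y : {linear V -> V}) (X' Y' : {linear W -> W})
    (d : {linear V -> W}) c a b :
  (forall v, d (X v) = X' (d v)) -> (forall v, d (Y v) = Y' (d v)) ->
  d (kbd X Y c a b) = kbd X' Y' (fun a b => d (c a b)) a b.
Proof.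
move=> dX dY.
have dkop (Z : {linear V -> V}) (Z' : {linear W -> W}) n v :
    (forall u, d (Z u) = Z' (d u)) -> d (kop Z n v) = kop Z' n (d v).
  move=> dZ; rewrite /kop; case: ifP => _ //.
  by elim: {1 2}e => //= q IHq; rewrite dZ IHq.
by rewrite /kbd linearD linearZ /= (dkop _ _ _ _ dX) (dkop _ _ _ _ dY).
Qed.

(* The connecting map of 0 -> ker d -> V -> im d -> 0 is injective in positive
   degrees when V is free. *)
Lemma indep_classes_shift (V W : lmodType k) (X Y : {linear V -> V})
    (X' Y' : {linear W -> W}) (d : {linear V -> W}) j s :
  (0 < e)%N -> (forall v, X (Y v) = Y (X v)) ->
  (forall u, iter e.+1 X u = 0) -> (forall u, iter e.+1 Y u = 0) ->
  free_like X Y ->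
  (forall v, d (X v) = X' (d v)) -> (forall v, d (Y v) = Y' (d v)) ->
  indep_classes X' Y' (fun w => exists v, d v = w) j.+1 s ->
  indep_classes X Y (fun v => d v = 0) j s.
Proof.
move=> e_gt0 XY Xn Yn freeV dX dY [c [imc cyc indc]].
have lift i a b : exists v, (a + b)%N = j.+1 -> d v = c i a b.
  have [ab|/eqP ab] := eqVneq (a + b)%N j.+1; last by exists 0.
  by have [v dv] := imc i a b ab; exists v.
pose c1 i a b := sval (cid (lift i a b)).
have dc1 i a b : (a + b)%N = j.+1 -> d (c1 i a b) = c i a b.
  by move=> ab; rewrite /c1; case: cid => v /= /(_ ab).
exists (fun i => kbd X Y (c1 i)); split=> [i a b ab|i a b ab|l f Sf lf].
- rewrite (kbd_map _ _ _ dX dY) (@eq_kbd _ _ _ _ (c i) j) //; last first.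
    by move=> *; apply: dc1.
  by apply: cyc; rewrite ab.
- exact: kbdK.
(* If a combination of the new classes is the boundary of [f] in ker d, the same combination of
   lifts minus [f] is a cycle over the free module, hence a boundary. Applying [d] bounds the
   combination of the [c i] in im d. *)
have [|w def_w] := @kbd_exact _ X Y XY e_gt0 Xn Yn freeV j
    (fun a b => \sum_i l i *: c1 i a b - f a b).
  by move=> a b ab; rewrite kbdB kbd_sum lf // subrr.
apply: (indc l (fun a b => d (w a b))) => [a b ab|a b ab]; first by exists (w a b).
rewrite -(kbd_map _ _ _ dX dY) -def_w // linearB /= Sf // subr0 linear_sum.
by apply: eq_bigr => i _; rewrite linearZ /= dc1.
Qed.

(** * The obstruction for bounded complexes of free modules *)

Section Sphere.
(** [D] models an augmented complex with degrees raised by one: [D 0] carries the trivial action,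
    and the homology of an [m]-sphere sits in [D m.+1], where [phi] embeds it in [k]. *)
Variables (D : nat -> lmodType k) (d : forall i, {linear D i.+1 -> D i}).
Variables (X Y : forall i, {linear D i -> D i}) (m N : nat) (u0 : D 0).
Variable phi : D m.+1 -> k.
Hypotheses (e_gt0 : (0 < e)%N) (XY : forall i v, X i (Y i v) = Y i (X i v)).
Hypotheses (Xn : forall i u, iter e.+1 (X i) u = 0).
Hypotheses (Yn : forall i u, iter e.+1 (Y i) u = 0).
Hypotheses (dX : forall i v, d i (X i.+1 v) = X i (d i v)).
Hypotheses (dY : forall i v, d i (Y i.+1 v) = Y i (d i v)).
Hypothesis freeD : forall i, free_like (X i.+1) (Y i.+1).
Hypotheses (X0 : forall v, X 0 v = 0) (Y0 : forall v, Y 0 v = 0) (u0_neq0 : u0 != 0).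
Hypothesis d0_surj : forall v, exists u, d 0 u = v.
Hypothesis dd : forall i v, d i (d i.+1 v) = 0.
Hypothesis exactD : forall i v, i != m -> d i v = 0 -> exists u, d i.+1 u = v.
Hypothesis phi_lin : forall r u v, d m u = 0 -> d m v = 0 ->
  phi (r *: u + v) = r * phi u + phi v.
Hypothesis phi_ker : forall v, d m v = 0 -> phi v = 0 -> exists u, d m.+1 u = v.
Hypothesis boundD : forall i (v : D i), (N <= i)%N -> v = 0.

Let IM i j s := indep_classes (X i) (Y i) (fun v => exists u, d i u = v) j s.
Let KR i j s := indep_classes (X i.+1) (Y i.+1) (fun v => d i v = 0) j s.

Let shift i j s : IM i j.+1 s -> KR i j s.
Proof. by apply: indep_classes_shift. Qed.

Let exact_step i j s : i != m -> KR i j s -> IM i.+1 j s.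
Proof.
move=> ne_im [c [Sc cyc indc]]; exists c; split=> [q a b ab||l f Sf].
- by apply: exactD => //; apply: Sc.
- exact: cyc.
by apply: indc => a b ab; have [u <-] := Sf a b ab; rewrite dd.
Qed.

(** All differentials vanish on the trivial module, so [u0] placed in each of the $j+1$ bidegrees of
    degree $j$ gives one class. *)
Let start j : IM 0 j j.+1.
Proof.
have k0 (V : lmodType k) (T : {linear V -> V}) a v :
    (forall u, T u = 0) -> kop T a v = 0.
  by rewrite /kop => T0; case: ifP => // _; case: (e) e_gt0 => //= q _; rewrite T0.
have kbd0 c a b : kbd (X 0) (Y 0) c a b = 0.
  by rewrite /kbd !k0 // scaler0 addr0.
exists (fun (i : 'I_j.+1) (a _ : nat) => if a == i then u0 else 0).
split=> [i a b _|//|l f _ lf i].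
  exact: d0_surj.
have := lf i (j - i)%N; rewrite kbd0 (bigD1 i) //= eqxx big1 => [|q ne_q]; last first.
  by rewrite ifN ?scaler0 // eq_sym.
have le_ij : (i <= j)%N by rewrite -ltnS.
rewrite addr0 subnKC // => /(_ erefl)/eqP.
by rewrite scaler_eq0 (negPf u0_neq0) orbF => /eqP.
Qed.

(** Each step trades one degree of Tor for one degree of the complex and keeps the classes, so their
    number is that of [start] in degree $j+i$. *)
Let indep_low i j : (i <= m)%N -> IM i j (j + i).+1.
Proof.
elim: i j => [|i IHi] j le_i; first by rewrite addn0; apply: start.
apply: exact_step; first by rewrite ltn_eqF.
by apply: shift; rewrite addnS -addSn; apply: IHi; apply: ltnW.
Qed.

Let indep_high t j : IM m.+1 (j + t) 1 -> IM (m.+1 + t) j 1.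
Proof.
elim: t j => [|t IHt] j; rewrite ?addn0 // !addnS -addSn => /IHt/shift.
by apply: exact_step; rewrite gtn_eqF // ltnS leq_addr.
Qed.

(** Shifting [N] more steps would give a nonzero class with values in [D (m.+1 + N)], which is
    zero. *)
Let no_high : ~ IM m.+1 N 1.
Proof.
rewrite -[N in IM _ N]add0n => /indep_high[c [_ _ indc]].
suff: (1 : k) = 0 by move/eqP; rewrite oner_eq0.
apply: (indc (fun=> 1) (fun _ _ => 0) _ _ ord0) => a b _.
  by exists 0; rewrite linear0.
have D0 (v : D (m.+1 + N)) : v = 0 by apply: boundD; rewrite leq_addl.
by rewrite [LHS]D0 [RHS]D0.
Qed.

(** Shifting up to [m] gives $N+m+2$ classes of degree $N$ in the kernel of [d m]. Through [phi]
    only $N+1$ coordinates remain, one per bidegree, so some nonzero combination takes all its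
    values in the image of [d m.+1], against [no_high]. *)
Theorem no_free_rank2_sphere : False.
Proof.
have [c [Sc cyc indc]] : KR m N (N.+1 + m).+1 by apply: shift; apply: indep_low.
apply: no_high; pose A := \matrix_(i < (N.+1 + m).+1, a < N.+1) phi (c i a (N - a)%N).
have phi_sum (l : 'I_(N.+1 + m).+1 -> k) a b : (a + b)%N = N ->
    d m (\sum_i l i *: c i a b) = 0 /\
    phi (\sum_i l i *: c i a b) = \sum_i l i * phi (c i a b).
  move=> ab; apply: (big_rec2 (fun u r => d m u = 0 /\ phi u = r)).
    have := @phi_lin (-1) 0 0 (linear0 _) (linear0 _).
    by rewrite scaler0 addr0 mulN1r addNr linear0.
  move=> i u r _ [du <-]; have dc := Sc i a b ab.
  by rewrite phi_lin // linearP /= dc du scaler0 addr0.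
have : kermx A != 0.
  rewrite kermx_eq0 /row_free neq_ltn (leq_ltn_trans (rank_leq_col A)) //.
  by rewrite ltnS leq_addr.
case/rowV0Pn=> l /sub_kermxP lA l_neq0.
exists (fun _ a b => \sum_i l 0 i *: c i a b); split=> [_ a b ab|_ a b ab|r f Sf].
- have [du phiu] := phi_sum (l 0) a b ab; apply: phi_ker => //; rewrite phiu.
  have lt_a : (a < N.+1)%N by rewrite ltnS -ab leq_addr.
  have /matrixP/(_ 0 (Ordinal lt_a)) := lA; rewrite !mxE => lA0; rewrite -[RHS]lA0.
  by apply: eq_bigr => i _; rewrite !mxE /= (_ : (N - a)%N = b) // -ab addKn.
- by rewrite kbd_sum big1 // => i _; rewrite cyc ?scaler0.
move=> rf q; rewrite ord1; apply/eqP; apply: contraNT l_neq0 => r_neq0.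
apply/eqP/rowP=> i; rewrite mxE; apply: (mulfI r_neq0); rewrite mulr0.
move: i; apply: (indc _ f) => a b ab.
  by have [u <-] := Sf a b ab; rewrite dd.
rewrite -rf // big_ord1 scaler_sumr; apply: eq_bigr => i _.
by rewrite scalerA.
Qed.
End Sphere.
End Koszul.

(** * From permutation actions of $(\mathbb Z/p)^2$ to nilpotent operators *)

(** In characteristic $p$, $X = g - 1$ identifies the group algebra of $\mathbb Z/p$ with
    $k[X]/(X^p)$. *)
Definition diffop (k : fieldType) (V : lmodType k) (g : {linear V -> V}) (v : V) : V :=
  g v - v.

Fact diffop_is_linear (k : fieldType) (V : lmodType k) (g : {linear V -> V}) :
  linear (diffop g).
Proof.
by move=> a u v; rewrite /diffop linearP scalerBr opprD !addrA (addrAC (a *: _)).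
Qed.
HB.instance Definition _ (k : fieldType) (V : lmodType k) (g : {linear V -> V}) :=
  GRing.isLinear.Build k V V _ (diffop g) (diffop_is_linear g).

Lemma diffop_comm (k : fieldType) (V : lmodType k) (g h : {linear V -> V}) :
  (forall v, g (h v) = h (g v)) ->
  forall v, diffop g (diffop h v) = diffop h (diffop g v).
Proof.
by move=> gh v; rewrite /diffop !linearB gh /= !opprK addrACA.
Qed.

Lemma pushf_delta (R : comNzRingType) (X Y : finType) (f : X -> Y) (x : X) :
  pushf f ([ffun z => (z == x)%:R] : {ffun X -> R^o}) = [ffun y => (y == f x)%:R].
Proof.
apply/ffunP=> y; rewrite !ffunE; have [->|ne_y] := eqVneq y (f x).
  rewrite (bigD1 x) //= ffunE eqxx big1 ?addr0 // => z /andP[_ /negPf ne_z].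
  by rewrite ffunE ne_z.
rewrite big1 // => z /eqP fz; rewrite ffunE.
by case: eqVneq => // zx; rewrite -fz zx eqxx in ne_y.
Qed.

Section Norm.
Variables (k : fieldType) (e : nat).
Hypothesis pchark : e.+1 \in [pchar k].

(** Frobenius gives $(X-1)^{e+1} = X^{e+1} - 1$; then $X - 1$ is cancelled. *)
Lemma sub1X_pchar : ('X - 1) ^+ e = \sum_(i < e.+1) 'X^i :> {poly k}.
Proof.
have Xn0 : 'X - 1 != 0 :> {poly k} by rewrite -size_poly_eq0 -polyC1 size_XsubC.
apply: (mulfI Xn0); rewrite -exprS -subrX1.
have pchark' : e.+1 \in [pchar {poly k}] by rewrite pchar_poly.
by have := pFrobenius_autB_comm pchark' (commr1 'X); rewrite !pFrobenius_autE expr1n.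
Qed.

Lemma iter_diffop (V : lmodType k) (g : {linear V -> V}) v :
  iter e (diffop g) v = \sum_(i < e.+1) iter i g v.
Proof.
(* This evaluates $(X-1)^n$ at [g]; the bound on [n] keeps all coefficients within the $e+1$ terms
   of the sum. *)
have H n : (n <= e)%N ->
    iter n (diffop g) v = \sum_(i < e.+1) (('X - 1) ^+ n : {poly k})`_i *: iter i g v.
  elim: n => [|n IHn] le_n.
    rewrite big_ord_recl expr0 coef1 scale1r big1 ?addr0 // => i _.
    by rewrite coef1 scale0r.
  have cn0 : (('X - 1) ^+ n : {poly k})`_e = 0.
    apply: nth_default; rewrite (leq_trans (size_poly_exp_leq _ _)) //.
    by rewrite -polyC1 size_XsubC mul1n.
  rewrite iterS [LHS]/diffop (IHn (ltnW le_n)) exprSr mulrBr mulr1.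
  under [RHS]eq_bigr do rewrite coefB scalerBl.
  rewrite sumrB; congr (_ - _).
  rewrite linear_sum big_ord_recr /= cn0 scale0r linear0 addr0.
  rewrite [RHS]big_ord_recl coefMX scale0r add0r; apply: eq_bigr => i _.
  by rewrite linearZ coefMX.
rewrite H // sub1X_pchar; apply: eq_bigr => i _.
rewrite coef_sum (bigD1 i) //= coefXn eqxx big1 ?addr0 ?scale1r // => j ne_ji.
by rewrite coefXn eq_sym -[_ == _]/(j == i) (negPf ne_ji).
Qed.

Lemma iter_diffop_p (V : lmodType k) (g : {linear V -> V}) v :
  (forall u, iter e.+1 g u = u) -> iter e.+1 (diffop g) v = 0.
Proof.
move=> gp; rewrite iterS iter_diffop [LHS]/diffop linear_sum big_ord_recr big_ord_recl /=.
by rewrite -[g _]/(iter e.+1 g v) gp [X in X - _]addrC subrr.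
Qed.

(* For the (Z/p)^2-action generated by sigma and tau, the kernel of the norm
   element on the span of a free orbit is the radical; q need only kill the
   non-free orbits. *)
Lemma perm_norm_ker_radical (X : finType) (sigma tau : X -> X) (W : lmodType k)
    (q : {linear {ffun X -> k^o} -> W}) (g h : {linear W -> W}) a :
  (forall x, sigma (tau x) = tau (sigma x)) ->
  (forall x, iter e.+1 sigma x = x) -> (forall x, iter e.+1 tau x = x) ->
  (forall b, q (pushf sigma b) = g (q b)) -> (forall b, q (pushf tau b) = h (q b)) ->
  (forall x i j, iter i sigma (iter j tau x) = x ->
     ~~ ((e.+1 %| i) && (e.+1 %| j))%N -> q [ffun y => (y == x)%:R] = 0) ->
  iter e (diffop (pushf sigma)) (iter e (diffop (pushf tau)) a) = 0 ->
  exists u w, q a = diffop g u + diffop h w.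
Proof.
move=> st sp tp qs qt bad Na.
pose inS w := exists u v, w = diffop g u + diffop h v.
have S0 : inS 0 by exists 0, 0; rewrite !linear0 addr0.
have SD u v : inS u -> inS v -> inS (u + v).
  move=> [u1 [u2 ->]] [v1 [v2 ->]]; exists (u1 + v1), (u2 + v2).
  by rewrite !linearD /= addrACA.
have SZ r u : inS u -> inS (r *: u).
  by move=> [u1 [u2 ->]]; exists (r *: u1), (r *: u2); rewrite !linearZ /= scalerDr.
pose delta x : {ffun X -> k^o} := [ffun y => (y == x)%:R].
have def_q b : q b = \sum_x b x *: q (delta x).
  rewrite -[in LHS](_ : \sum_x b x *: delta x = b) ?linear_sum.
    by apply: eq_bigr => x _; rewrite linearZ.
  apply/ffunP=> y; rewrite sum_ffunE (bigD1 y) //= !ffunE eqxx big1 ?addr0.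
    by rewrite /GRing.scale /= mulr1.
  by move=> x ne_xy; rewrite !ffunE eq_sym (negPf ne_xy) scaler0.
have pushd (f : X -> X) x : pushf f (delta x) = delta (f x) by apply: pushf_delta.
have Ss x : inS (q (delta (sigma x)) - q (delta x)).
  by exists (q (delta x)), 0; rewrite linear0 addr0 -pushd qs.
have St x : inS (q (delta (tau x)) - q (delta x)).
  by exists 0, (q (delta x)); rewrite linear0 add0r -pushd qt.
have iterp (f : X -> X) n x : (forall y, iter e.+1 f y = y) -> iter (e.+1 * n) f x = x.
  by move=> fp; elim: n => [|n IHn]; rewrite ?muln0 // mulnS iterD IHn fp.
have iter_mod (f : X -> X) m n x : (forall y, iter e.+1 f y = y) ->
    m = n %[mod e.+1] -> iter m f x = iter n f x.
  move=> fp mn; rewrite (divn_eq m e.+1) (divn_eq n e.+1) mn ![(_ %/ _ * _)%N]mulnC.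
  by rewrite 2!(iterD (e.+1 * _)%N) !iterp.
pose A m n x := iter m sigma (iter n tau x).
have AA m n m' n' x : A m n (A m' n' x) = A (m + m')%N (n + n')%N x.
  rewrite /A !iterD; congr (iter m sigma _).
  elim: m' => //= m' <-; elim: n => //= n ->; by rewrite st.
have A_mod m n m' n' x : m = m' %[mod e.+1] -> n = n' %[mod e.+1] -> A m n x = A m' n' x.
  by move=> mm nn; rewrite /A (iter_mod _ _ _ _ tp nn) (iter_mod _ _ _ _ sp mm).
(* Since $e \equiv -1$ modulo $e+1$, multiplying the exponents by $e$ inverts. *)
have A_inv m n x : A (e * m)%N (e * n)%N (A m n x) = x.
  by rewrite AA !(addnC (e * _)%N) -!mulSn /A !iterp.
have Ss_iter m n x : inS (q (delta (A m n x)) - q (delta x)).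
  elim: m => [|m IHm]; last first.
    by rewrite -(subrK (q (delta (A m n x))) (q _)) -addrA; apply: SD (Ss _) IHm.
  elim: n => [|n IHn]; first by rewrite subrr.
  by rewrite -(subrK (q (delta (A 0 n x))) (q _)) -addrA; apply: SD (St _) IHn.
pose act x (ij : 'I_e.+1 * 'I_e.+1) := A (e * ij.1)%N (e * ij.2)%N x.
pose orb x := [set act x ij | ij in predT].
have orbP x y : reflect (exists m n, y = A m n x) (y \in orb x).
  apply: (iffP imsetP) => [[ij _ ->]|[m [n ->]]].
    by exists (e * ij.1)%N, (e * ij.2)%N.
  exists (inord ((e * m) %% e.+1), inord ((e * n) %% e.+1)) => //.
  have ee l : l = e * ((e * l) %% e.+1) %[mod e.+1].
    rewrite modnMmr mulnA; case: (e) => [|d]; first by rewrite !modn1.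
    have -> : (d.+1 * d.+1 * l = d * l * d.+2 + l)%N by ring.
    by rewrite modnMDl.
  by rewrite /act /= !inordK ?ltn_mod //; apply: A_mod.
have orb_refl x : x \in orb x by apply/orbP; exists 0%N, 0%N.
have orb_eq x y : y \in orb x -> orb y = orb x.
  case/orbP=> m [n ->]; apply/setP=> z; apply/orbP/orbP=> [[m' [n' ->]]|[m' [n' ->]]].
    by rewrite AA; do 2!eexists.
  by rewrite -{1}(A_inv m n x) AA; do 2!eexists.
(* A chosen point in each orbit; the default is never taken, because [x] itself qualifies. *)
pose r x := odflt x [pick y | orb y == orb x].
have orb_r x : orb (r x) = orb x.
  by rewrite /r; case: pickP => [y /eqP //|/(_ x)]; rewrite eqxx.
have r_eq x y : orb x = orb y -> r x = r y.
  move=> xy; rewrite /r -xy; case: pickP => // /(_ x); by rewrite eqxx.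
have Sr x : inS (q (delta x) - q (delta (r x))).
  by have /orbP[m [n {1}->]] : x \in orb (r x) by rewrite orb_r.
(* Modulo the radical each [delta x] may be replaced by that of its representative; it remains to
   see that the resulting sum vanishes. *)
suff -> : q a = \sum_x a x *: (q (delta x) - q (delta (r x))).
  by apply: (big_ind inS) => // x _; apply: SZ.
under eq_bigr do rewrite scalerBr.
rewrite sumrB -def_q (_ : \sum_x a x *: q (delta (r x)) = 0) ?subr0 //.
rewrite (partition_big r predT) //=; apply: big1 => y _.
under eq_bigr => x /eqP -> do [].
rewrite -scaler_suml.
have [q0|q_neq0] := eqVneq (q (delta y)) 0; first by rewrite q0 scaler0.
case: (pickP [pred x | r x == y]) => [x0 /= /eqP rx0|no_x]; last first.
  by rewrite big_pred0 ?scale0r // => x; have := no_x x.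
have rE x : (r x == y) = (x \in orb y).
  apply/eqP/idP=> [<-|/orb_eq/r_eq ->]; first by rewrite orb_r.
  by rewrite -rx0; apply: r_eq; rewrite orb_r.
(* As [q] does not kill [delta y], the orbit of [y] is free and [act y] parametrises it injectively.
   The sum of [a] over it is then the norm of [a] at [y], which is 0. *)
rewrite (eq_bigl _ _ rE) big_imset /=; last first.
  move=> [i j] [i' j'] _ _ /(congr1 (A i' j')).
  rewrite /act /= !AA -!mulSn => eqA.
  have /andP[dvi dvj] : (e.+1 %| i' + e * i)%N && (e.+1 %| j' + e * j)%N.
    apply: contraNT q_neq0 => ndiv; apply/eqP; apply: bad ndiv.
    by rewrite -/(A _ _ y) eqA /A !iterp.
  have modE l l' : (l < e.+1)%N -> (l' < e.+1)%N -> (e.+1 %| l' + e * l)%N -> l = l'.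
    move=> lt_l lt_l' dv; rewrite -(modn_small lt_l) -(modn_small lt_l').
    have : (l * e.+1 + l' = (l' + e * l) + l)%N by lia.
    move/(congr1 (modn^~ e.+1)); rewrite modnMDl -modnDml (eqP dv) add0n; exact: esym.
  by rewrite (val_inj (modE _ _ (ltn_ord i) (ltn_ord i') dvi))
    (val_inj (modE _ _ (ltn_ord j) (ltn_ord j') dvj)).
(* The pushforward along $f^m$ evaluates at $f^{-m}$, written $f^{em}$. *)
have push_iter (f : X -> X) b m z : (forall x, iter e.+1 f x = x) ->
    iter m (pushf f) b z = b (iter (e * m)%N f z).
  move=> fp; elim: m z => [|m IHm] z; first by rewrite muln0.
  rewrite iterS ffunE (big_pred1 (iter e f z)) => [|x].
    by rewrite IHm mulnS addnC iterD.
  apply/eqP/eqP=> [<-|->]; last exact: fp.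
  by rewrite -iterSr fp.
rewrite (_ : \sum_(ij in predT) a (act y ij) =
    iter e (diffop (pushf sigma)) (iter e (diffop (pushf tau)) a) y).
  by rewrite Na ffunE scale0r.
rewrite !iter_diffop sum_ffunE.
rewrite (eq_bigl predT) // -(pair_bigA _ (fun i j => a (act y (i, j)))) /=.
apply: eq_bigr => i _; rewrite push_iter // sum_ffunE; apply: eq_bigr => j _.
rewrite push_iter // /act /A /=; congr (a _).
elim: (e * i)%N => //= m ->.
elim: (e * j)%N => //= n <-; by rewrite st.
Qed.
End Norm.

(** * Maps between orbits *)

Section GMaps.
Variable gT : finGroupType.
Implicit Types H K L : {group gT}.

Lemma orb_act_repr K (x : orb K) : orb_act (repr (val x)) (orb_base K) = x.
Proof. by apply: val_inj; rewrite /= -orb_rep. Qed.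

(** The map $gH \mapsto gy$ is well defined because $H$ fixes $y$. *)
Lemma gmap_exists H L (y : orb L) :
  (forall a, a \in H -> orb_act a y = y) ->
  exists f : gmap H L, f (orb_base H) = y.
Proof.
move=> Hy; have y_fix : [forall a in H, orb_act a y == y].
  by apply/forallP=> a; apply/implyP=> /Hy ->.
pose z : orb_fix L H := exist _ y y_fix.
have f_eq : [forall g : gT, forall x : orb H,
    [ffun x : orb H => orb_act (repr (val x)) y] (orb_act g x) ==
    orb_act g ([ffun x : orb H => orb_act (repr (val x)) y] x)].
  apply/forallP=> g; apply/forallP=> x; rewrite !ffunE -orb_actM; apply/eqP.
  by apply: (orb_act_indep z); rewrite orb_actM !orb_act_repr.
exists (GMap f_eq); rewrite /= ffunE -[RHS]orb_act1.
by apply: (orb_act_indep z); rewrite orb_act_repr orb_act1.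
Qed.

Lemma gmap_inj H L (f h : gmap H L) : f (orb_base H) = h (orb_base H) -> f = h.
Proof.
move=> fh; have : gmap_fun f = gmap_fun h.
  by apply/ffunP=> x; rewrite -(orb_act_repr x) !gmapJ fh.
case: f h {fh} => f p [h q] /= fh; move: p q; rewrite fh => p q.
by congr GMap; apply: eq_irrelevance.
Qed.

Lemma fix_mapE H K (f : gmap K K) a (x : orb_fix H K) :
  f (orb_base K) = orb_act a (orb_base K) -> val (fix_map f x) = orb_act a (val x).
Proof. by rewrite gmap_repE => /(orb_act_indep x). Qed.

End GMaps.

(** * Projective modules evaluated at one orbit *)

Section Modules.
Variables (gT : finGroupType) (F : {set {group gT}}) (k : fieldType) (e : nat).
Hypothesis pchark : e.+1 \in [pchar k].
Implicit Types (M N : rgmod F k) (H K : orb_ob F).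

Lemma free_like_map (V W : lmodType k) (g h : {linear V -> V}) (g' h' : {linear W -> W})
    (phi : {linear V -> W}) v :
  (forall u, phi (g u) = g' (phi u)) -> (forall u, phi (h u) = h' (phi u)) ->
  phi (iter e (diffop g) (iter e (diffop h) v)) =
  iter e (diffop g') (iter e (diffop h') (phi v)).
Proof.
have it (a : {linear V -> V}) (a' : {linear W -> W}) n u :
    (forall u, phi (a u) = a' (phi u)) ->
    phi (iter n (diffop a) u) = iter n (diffop a') (phi u).
  by move=> aa; elim: n => // n IHn; rewrite !iterS -IHn /diffop linearB aa.
by move=> gg hh; rewrite (it _ _ _ _ gg) (it _ _ _ _ hh).
Qed.

(** [f] is $gH \mapsto gsH$, so its [n]-th iterate is $gH \mapsto gs^nH$, the identity. *)
Lemma rg_map_iter M H (f : orb_mor H H) s n :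
  f (orb_base (val H)) = orb_act s (orb_base (val H)) ->
  (s ^+ n)%g \in val H -> forall v, iter n (rg_map M f) v = v.
Proof.
move=> fs sn v; pose fn := iter n (gmap_comp f) (gmap_id (val H)) : orb_mor H H.
have fnE m : iter m (gmap_comp f) (gmap_id (val H)) (orb_base (val H)) =
    orb_act (s ^+ m)%g (orb_base (val H)).
  elim: m => [|m IHm]; first by rewrite /= ffunE orb_act1.
  by rewrite iterS /= ffunE IHm gmapJ fs -orb_actM -expgSr.
have <- : rg_map M fn v = iter n (rg_map M f) v.
  rewrite /fn; elim: {sn fn} n v => [|n IHn] v; first by rewrite /= rg_map_id.
  by rewrite [iter _ (gmap_comp f) _]iterS rg_map_comp IHn -iterSr.
have -> : fn = gmap_id (val H); last exact: rg_map_id.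
apply: gmap_inj; rewrite fnE /= ffunE; apply: val_inj => /=.
exact: lcoset_id.
Qed.

Lemma rg_map_comm M H (f h : orb_mor H H) s t :
  f (orb_base (val H)) = orb_act s (orb_base (val H)) ->
  h (orb_base (val H)) = orb_act t (orb_base (val H)) ->
  orb_act (s * t)%g (orb_base (val H)) = orb_act (t * s)%g (orb_base (val H)) ->
  forall v, rg_map M f (rg_map M h v) = rg_map M h (rg_map M f v).
Proof.
move=> fs ht st v; rewrite -!rg_map_comp; congr (rg_map M _ v).
by apply: gmap_inj; rewrite /= !ffunE fs ht !gmapJ fs ht -!orb_actM.
Qed.

(** In a free module containing [M] as a summand, the components of [v] are each killed by the norm,
    as the sum is direct. [perm_norm_ker_radical] puts their images in the radical of [M H]: a basis
    point outside the free orbits is killed by every map to [M]. *)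
Lemma projective_free_like M H (f h : orb_mor H H) s t :
  f (orb_base (val H)) = orb_act s (orb_base (val H)) ->
  h (orb_base (val H)) = orb_act t (orb_base (val H)) ->
  orb_act (s * t)%g (orb_base (val H)) = orb_act (t * s)%g (orb_base (val H)) ->
  (s ^+ e.+1)%g \in val H -> (t ^+ e.+1)%g \in val H ->
  (forall K (phi : rghom (orbmod k K) M) (x : orb_fix (val K) (val H)) i j,
     orb_act (s ^+ i * t ^+ j)%g (val x) = val x ->
     ~~ ((e.+1 %| i) && (e.+1 %| j))%N -> phi H [ffun y => (y == x)%:R] = 0) ->
  is_projective M ->
  free_like e (diffop (rg_map M f)) (diffop (rg_map M h)).
Proof.
move=> fs ht st sp tp bad [N [I [L [iota /(_ H)[gen ind]]]]] v Nv.
pose FM := dsum2 M N.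
pose iM (u : M H) : FM H := (u, 0).
have iM_lin : linear iM.
  by move=> a u w; rewrite /iM; congr pair; rewrite /= scaler0 addr0.
pose iML : {linear M H -> FM H} :=
  HB.pack iM (GRing.isLinear.Build k (M H) (FM H) _ iM iM_lin).
have iMf (f0 : orb_mor H H) u : iML (rg_map M f0 u) = rg_map FM f0 (iML u).
  by rewrite /= /iM /= /dsum2_fun /= linear0.
have [js [a [js_uniq def_v]]] := gen (iM v).
pose norm i := iter e (diffop (rg_map (orbmod k (L i)) f))
  (iter e (diffop (rg_map (orbmod k (L i)) h)) (a i)).
have Na i : i \in js -> norm i = 0.
  move=> i_js; apply: (ind js norm) i_js => //; rewrite /norm.
  have iNv : iML (iter e (diffop (rg_map M f)) (iter e (diffop (rg_map M h)) v)) = 0.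
    by rewrite Nv linear0.
  rewrite -[RHS]iNv.
  rewrite (free_like_map (g' := rg_map FM f) (h' := rg_map FM h)) //.
  rewrite [iML v]def_v.
  have iN (f0 : orb_mor H H) j u :
      iota j H (rg_map (orbmod k (L j)) f0 u) = rg_map FM f0 (iota j H u).
    exact: (rg_natural (iota j) f0 u).
  under eq_bigr => j _ do rewrite (free_like_map _ (iN f j) (iN h j)).
  by rewrite !linear_sum.
pose pM K (u : FM K) : M K := u.1.
have pM_lin K : linear (@pM K) by [].
pose pML K : {linear FM K -> M K} :=
  HB.pack (@pM K) (GRing.isLinear.Build k (FM K) (M K) _ (@pM K) (pM_lin K)).
(* The inclusion of a free summand followed by the projection to [M]: the maps to which [bad] will
   be applied. *)
pose phi_fun i K : {linear orbmod k (L i) K -> M K} := pML K \o iota i K.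
have phi_nat i K K' (f0 : orb_mor K K') x :
    phi_fun i K (rg_map (orbmod k (L i)) f0 x) = rg_map M f0 (phi_fun i K' x).
  by rewrite /phi_fun /= (rg_natural (iota i) f0 x).
pose phi i := RGHom (phi_nat i).
have -> : v = \sum_(i <- js) phi i H (a i).
  by rewrite -[LHS]/(pML H (iM v)) def_v linear_sum.
have val_iter (f0 : orb_mor H H) r K m (x : orb_fix (val K) (val H)) :
    f0 (orb_base (val H)) = orb_act r (orb_base (val H)) ->
    val (iter m (fix_map f0) x) = orb_act (r ^+ m)%g (val x).
  move=> f0r; elim: m => [|m IHm]; first by rewrite orb_act1.
  by rewrite iterS (fix_mapE _ f0r) IHm -orb_actM -expgS.
suff H1 i : i \in js -> exists u w,
    phi i H (a i) = diffop (rg_map M f) u + diffop (rg_map M h) w.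
  move: H1; elim: (js) => [|i s' IHs] H1.
    by exists 0, 0; rewrite big_nil !linear0 addr0.
  have [|u [w eq1]] := H1 i; first exact: mem_head.
  have [|u' [w' eq2]] := IHs; first by move=> j j_s; apply: H1; rewrite inE j_s orbT.
  exists (u + u'), (w + w').
  by rewrite big_cons eq1 eq2 !linearD /= addrACA.
move=> /Na; apply: (perm_norm_ker_radical pchark).
- move=> x; apply: val_inj; rewrite (fix_mapE _ fs) (fix_mapE _ ht) (fix_mapE _ ht).
  rewrite (fix_mapE _ fs) -!orb_actM; exact: (orb_act_indep x).
- by move=> x; apply: val_inj; rewrite (val_iter _ _ _ _ _ fs) (orb_fixP x).
- by move=> x; apply: val_inj; rewrite (val_iter _ _ _ _ _ ht) (orb_fixP x).
- by move=> b; rewrite -(phi_nat i).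
- by move=> b; rewrite -(phi_nat i).
move=> x i1 j1 /(congr1 val); rewrite (val_iter _ _ _ _ _ fs) (val_iter _ _ _ _ _ ht).
by rewrite -orb_actM; apply: bad (phi i) _ _ _.
Qed.
End Modules.

(** * Exactness read off from homology quotients *)

Section HomologyFacts.
Variables (R : pzRingType) (U V W : lmodType R).
Variables (f : {linear U -> V}) (g : {linear V -> W}).
Local Open Scope quotient_scope.

Let Q := quotmod (@boundary_pred_scale R U V W f g).
(** Non-cycles are sent to the zero cycle, so classes are defined on all of [V] while linearity is
    claimed on cycles only. Hence [phi] in [homology_rank1] is a plain function. *)
Let cyc v : cycle_mod g := insubd (0 : cycle_mod g) v.
Let cls v : homology f g := \pi_Q (cyc v).

Let val_cyc v : g v = 0 -> val (cyc v) = v.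
Proof. by move=> gv; rewrite insubdK // unfold_in; apply/eqP. Qed.

Let cls_lin a u v : g u = 0 -> g v = 0 -> cls (a *: u + v) = a *: cls u + cls v.
Proof.
move=> gu gv; rewrite /cls (_ : cyc _ = a *: cyc u + cyc v).
  by rewrite /Q quotmod_piD quotmod_piZ.
by apply: val_inj; rewrite val_cyc ?linearP ?gu ?gv ?scaler0 ?addr0 //= !val_cyc.
Qed.

Let Q0 : \pi_Q 0 = 0 :> homology f g.
Proof. by apply: (@addrI _ (\pi_Q 0 : homology f g)); rewrite -quotmod_piD !addr0. Qed.

Let cls_eq0 v : g v = 0 -> cls v = 0 -> exists u, f u = v.
Proof.
move=> gv clsv; have /eqP : \pi_Q (cyc v) = \pi_Q 0.
  by rewrite -[LHS]/(cls v) clsv -[LHS]Q0.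
rewrite -Quotient.idealrBE subr0 unfold_in => /asboolP[u].
by rewrite val_cyc // => <-; exists u.
Qed.

Lemma homology_eq0_exact : (forall x : homology f g, x = 0) ->
  forall v, g v = 0 -> exists u, f u = v.
Proof. by move=> H0 v gv; apply: cls_eq0. Qed.

Lemma homology_surj_eq0 : (forall v, exists u, f u = v) -> forall x : homology f g, x = 0.
Proof.
move=> f_surj x; elim/quotW: x => z.
rewrite -[RHS]Q0; apply/eqP; rewrite -Quotient.idealrBE subr0 unfold_in.
by apply/asboolP; apply: f_surj.
Qed.

Lemma homology_rank1 (h : {linear homology f g -> R^o}) : bijective h ->
  exists phi : V -> R,
    (forall r u v, g u = 0 -> g v = 0 -> phi (r *: u + v) = r * phi u + phi v) /\
    (forall v, g v = 0 -> phi v = 0 -> exists u, f u = v).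
Proof.
move=> /bij_inj inj_h; exists (fun v => h (cls v)); split=> [r u v gu gv|v gv].
  by rewrite cls_lin // linearP.
by move=> h0; apply: cls_eq0 => //; apply: inj_h; rewrite linear0.
Qed.

End HomologyFacts.

(** * Basis elements that factor through a larger subgroup *)

Section Vanishing.
Variables (gT : finGroupType) (F : {set {group gT}}) (k : fieldType).

(** The basis element of a point fixed by $L$ is restricted along $G/H \to G/L$, so by naturality
    its image comes from $M(L) = 0$. *)
Lemma rghom_delta_eq0 (M : rgmod F k) (K H L : orb_ob F) (phi : rghom (orbmod k K) M)
    (x : orb_fix (val K) (val H)) :
  val H \subset val L -> (forall a, a \in val L -> orb_act a (val x) = val x) ->
  (forall u : M L, u = 0) -> phi H [ffun y => (y == x)%:R] = 0.
Proof.
move=> sHL Lx M0.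
have x_fix : [forall a in val L, orb_act a (val x) == val x].
  by apply/forallP=> a; apply/implyP=> /Lx ->.
have [|f fE] := @gmap_exists _ (val H) (val L) (orb_base (val L)).
  by move=> a Ha; apply: val_inj; rewrite /= lcoset_id // (subsetP sHL).
pose x' : orb_fix (val K) (val L) := exist _ (val x) x_fix.
have <- : fix_map (f : orb_mor H L) x' = x.
  apply: val_inj; rewrite /= -[RHS]orb_act1; apply: (orb_act_indep x').
  by rewrite -gmap_repE fE orb_act1.
rewrite -pushf_delta -[pushf _ _]/(rg_map (orbmod k K) (f : orb_mor H L) _).
by rewrite rg_natural [phi L _]M0 linear0.
Qed.
End Vanishing.

(** * Homology spheres with an action of $(\mathbb Z/p)^2$ *)

Section SphereVanishing.
Variables (gT : finGroupType) (F : {set {group gT}}) (k : fieldType).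
Variables (n : {group gT} -> int) (C : chain_complex F k).
Hypothesis sphereC : is_homology_sphere n C.

(** If $C(H)$ were nonzero, the augmentation would be onto and the reduced homology in degree $-1$
    would vanish, whereas $n(H) = -1$ makes it [k]. *)
Lemma sphere_dim_lt0_eq0 (H : orb_ob F) : n (val H) < 0 ->
  forall i (u : C i H), u = 0.
Proof.
case: sphereC => eps [[_ eps_surj] homC] nH i u; have [le_n homH] := homC H.
have nE : n (val H) = -1 by lia.
have /= := homH 0%N; rewrite nE /= => -[h bij_h].
apply: contrapT => u_neq0.
have homC0 := homology_surj_eq0 (f := eps H) (g := \0 : {linear k^o -> k^o})
  (eps_surj H (ex_intro _ i (ex_intro _ u u_neq0))).
have [h' _ h'K] := bij_h; have /eqP := h'K 1.
by rewrite (homC0 (h' 1)) linear0 eq_sym oner_eq0.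
Qed.

Variable e : nat.
Hypotheses (pchark : e.+1 \in [pchar k]) (e_gt0 : (0 < e)%N).
Hypotheses (finC : is_finite_complex C) (projC : is_projective_complex C).

(** [s] and [t] normalise $H$ and make $C(H)$ a complex of free $(\mathbb Z/p)^2$-modules, so
    [no_free_rank2_sphere] excludes dimensions $\ge 0$. *)
Lemma sphere_dim_lt0 (H : orb_ob F) (s t : gT) :
  orb_act (s * t)%g (orb_base (val H)) = orb_act (t * s)%g (orb_base (val H)) ->
  s \in 'N(val H)%g -> t \in 'N(val H)%g ->
  (s ^+ e.+1)%g \in val H -> (t ^+ e.+1)%g \in val H ->
  (forall l (K : orb_ob F) (phi : rghom (orbmod k K) (C l))
       (x : orb_fix (val K) (val H)) i j,
     orb_act (s ^+ i * t ^+ j)%g (val x) = val x ->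
     ~~ ((e.+1 %| i) && (e.+1 %| j))%N -> phi H [ffun y => (y == x)%:R] = 0) ->
  n (val H) < 0.
Proof.
move=> st Ns Nt sp tp bad; rewrite ltNge; apply/negP=> n_ge0.
case: sphereC => eps [[eps_d _] homC]; have [_ homH] := homC H.
have gmapN r : r \in 'N(val H)%g -> exists f : gmap (val H) (val H),
    f (orb_base (val H)) = orb_act r (orb_base (val H)).
  move=> Nr; apply: gmap_exists => a Ha; apply: val_inj => /=.
  by rewrite -lcosetM conjgC lcosetM lcoset_id // memJ_norm.
have [f fs] := gmapN s Ns; have [h ht] := gmapN t Nt.
have [m nE] : exists m : nat, n (val H) = m by exists `|n (val H)|%N; rewrite gez0_abs.
(* The augmented complex, shifted so that the coefficients sit in degree 0; the bound [N] on its
   length accordingly becomes [N.+1]. *)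
pose D i : lmodType k := if i is j.+1 then C j H else k^o.
pose d i : {linear D i.+1 -> D i} :=
  match i with 0%N => eps H | j.+1 => ch_d C j H end.
pose act (g : gmap (val H) (val H)) i : {linear D i -> D i} :=
  match i with 0%N => @idfun k^o | j.+1 => rg_map (C j) (g : orb_mor H H) end.
have act_d g i v : d i (act g i.+1 v) = act g i (d i v).
  by case: i v => [|i] v; rewrite /= rg_natural.
have act_comm i v : act f i (act h i v) = act h i (act f i v).
  case: i v => [|i] v //; exact: (@rg_map_comm _ _ _ (C i) H f h s t fs ht st).
have act_p (g : gmap (val H) (val H)) r i (v : D i) :
    g (orb_base (val H)) = orb_act r (orb_base (val H)) ->
    (r ^+ e.+1)%g \in val H -> iter e.+1 (act g i) v = v.
  move=> gr rp; case: i v => [|i] v; last exact: (@rg_map_iter _ _ _ (C i) H g r _ gr rp).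
  by elim: {rp} e.+1 => //= q ->.
have hom_eq j : j != m -> forall v, d j v = 0 -> exists u, d j.+1 u = v.
  move=> ne_jm; have := homH j.+1; rewrite ifN; last by rewrite nE; lia.
  by case: j ne_jm => [|j] _; apply: homology_eq0_exact.
have [phi [phi_lin phi_ker]] : exists phi : D m.+1 -> k,
    (forall r u v, d m u = 0 -> d m v = 0 -> phi (r *: u + v) = r * phi u + phi v) /\
    (forall v, d m v = 0 -> phi v = 0 -> exists u, d m.+1 u = v).
  have := homH m.+1; rewrite nE ifT; last by lia.
  by case: (m) => [|m'] [h0 bij_h]; apply: homology_rank1 bij_h.
have [[N boundC] _] := finC.
apply: (@no_free_rank2_sphere k e D d
  (fun i => diffop (act f i)) (fun i => diffop (act h i)) m N.+1 (1 : k^o) phi) => //.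
- by move=> i; apply: diffop_comm.
- by move=> i u; apply: iter_diffop_p => // w; apply: act_p fs sp.
- by move=> i u; apply: iter_diffop_p => // w; apply: act_p ht tp.
- by move=> i v; rewrite /diffop linearB act_d.
- by move=> i v; rewrite /diffop linearB act_d.
- by move=> i; apply: (@projective_free_like _ _ _ _ pchark (C i) H f h s t fs ht) => //;
     apply: bad.
- by move=> v; apply: subrr.
- by move=> v; apply: subrr.
- exact: oner_neq0.
- have := homH 0%N; rewrite ifN; last by rewrite nE; lia.
  by move=> /homology_eq0_exact eps_surj v; apply: eps_surj.
- by case=> [|i] v; rewrite /= ?eps_d // ch_dd.
- by move=> i v ne_im; apply: hom_eq.
- by case=> [|i] v le_Ni; [case: (N) le_Ni | exact: (boundC i le_Ni H v)].
Qed.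
End SphereVanishing.

Lemma p_rank_ge2 (gT : finGroupType) (p : nat) (K : {group gT}) (x y : gT) :
  prime p -> x \in K -> y \in K -> commute x y -> #[x]%g = p -> (y ^+ p = 1)%g ->
  y \notin <[x]>%g -> (2 <= 'r_p(K)%g)%N.
Proof.
move=> p_pr Kx Ky cxy ox yp ynx.
have oy : #[y]%g = p.
  by apply: nt_prime_order => //; apply: contraNneq ynx => ->.
have tiyx : (<[x]> :&: <[y]> = 1)%g.
  rewrite setIC prime_TIg -?orderE ?oy //; by rewrite cycle_subG.
have cyx : (<[y]> \subset 'C(<[x]>))%g.
  by rewrite cycle_subG; apply/centP=> u /cycleP[i ->]; apply/commuteX/commute_sym.
have defE := dprodEY cyx tiyx.
apply/p_rank_geP; exists (<[x]> <*> <[y]>)%G.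
rewrite !inE /= join_subG !cycle_subG Kx Ky /=.
rewrite (dprod_abelem p defE) !cycle_abelem ?p_pr ?orbT // ox oy dvdnn /= cent_joinEr //.
by rewrite TI_cardMg // -!orderE ox oy (pfactorK 2).
Qed.

(** * Fixed points and the rank condition *)

Section GroupSteps.
Variables (gT : finGroupType) (p : nat).
Hypotheses (p_pr : prime p) (p_odd : odd p).
Let F := rank_le1_family gT p.
Variables (n : {group gT} -> int) (C : chain_complex F 'F_p).
Hypotheses (finC : is_finite_complex C) (projC : is_projective_complex C).
Hypothesis sphereC : is_homology_sphere n C.

Lemma cycle_rank_le1 (z : gT) : <[z]>%G \in F.
Proof.
rewrite inE (leq_trans (p_rank_le_rank p _)) //.
by rewrite -abelian_rank1_cyclic ?cycle_abelian ?cycle_cyclic.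
Qed.

Let pcharFp : p.-1.+1 \in [pchar 'F_p].
Proof. by rewrite prednK ?prime_gt0 // pchar_Fp. Qed.

Let p1_gt0 : (0 < p.-1)%N. Proof. by case: (p) p_pr => [|[|]]. Qed.

Lemma orb_act_fixP (K : {group gT}) (x : orb K) y :
  orb_act y x = x -> (y ^ repr (val x))%g \in K.
Proof.
move=> /(congr1 val) /= yx; move: yx; rewrite {1 2}(orb_rep x) -lcosetM => /lcoset_eqP.
by rewrite mem_lcoset conjgE.
Qed.

(** If $y = s^i t^j \notin \langle z\rangle$ fixed a point $bK$ of $(G/K)^{\langle z\rangle}$, then
    $z^b$ and $y^b$ would generate a subgroup of order $p^2$ of $K$. So every orbit is free. *)
Lemma center_dim_lt0 (z s t : gT) :
  z != 1%g -> (z ^+ p = 1)%g -> (s ^+ p = 1)%g -> (t ^+ p = 1)%g ->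
  commute s z -> commute t z -> [~ s, t]%g \in <[z]>%g ->
  (forall i j, (s ^+ i * t ^+ j)%g \in <[z]>%g -> (p %| i)%N && (p %| j)%N) ->
  n <[z]>%G < 0.
Proof.
move=> z1 zp sp tp sz tz st ind.
pose H : orb_ob F := exist _ <[z]>%G (cycle_rank_le1 z).
have oz : #[z]%g = p by apply: nt_prime_order.
have cent_z u v : commute u z -> v \in <[z]>%g -> commute u v.
  by move=> uz /cycleP[i ->]; apply: commuteX.
have Nz u : commute u z -> u \in 'N(<[z]>)%g.
  by move=> uz; apply: (subsetP (cent_sub _)); apply/centP=> v; apply: cent_z.
apply: (@sphere_dim_lt0 _ F _ n C sphereC _ pcharFp p1_gt0 finC projC H s t).
- apply: val_inj => /=; apply/lcoset_eqP; rewrite mem_lcoset /=.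
  have -> : ((t * s)^-1 * (s * t) = [~ s, t])%g.
    by rewrite /commg /conjg invMg !mulgA.
  done.
- exact: Nz.
- exact: Nz.
- by rewrite prednK ?prime_gt0 // sp group1.
- by rewrite prednK ?prime_gt0 // tp group1.
move=> l K phi x i j; rewrite prednK ?prime_gt0 //.
set y := (s ^+ i * t ^+ j)%g => yx nij; exfalso.
have y_notin : y \notin <[z]>%g by apply: contra nij; apply: ind.
have yz : commute y z.
  by apply/commute_sym/commuteM; apply/commuteX/commute_sym.
have st_ij : [~ t ^+ j, s ^+ i]%g \in <[z]>%g.
  have ts : [~ t, s]%g \in <[z]>%g by rewrite -invg_comm groupV.
  have ts_j : [~ t ^+ j, s]%g \in <[z]>%g.
    by rewrite commXg ?groupX //; apply: cent_z.
  by rewrite commgX ?groupX //; apply: cent_z.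
(* In class 2, $y^p = s^{ip} t^{jp} [t^j, s^i]^{p(p-1)/2}$, and $p$ divides the last exponent
   because it is odd. *)
have yp : (y ^+ p = 1)%g.
  rewrite /y expMg_Rmul; try (apply: cent_z => //; exact/commute_sym/commuteX/commute_sym).
  rewrite -!expgM mulnC expgM sp expg1n mulnC expgM tp expg1n !mul1g.
  have /cycleP[m ->] := st_ij; rewrite -expgM.
  have /dvdnP[q ->] : (p %| 'C(p, 2))%N.
    apply: prime_dvd_bin => //=; rewrite ltn_neqAle prime_gt1 // andbT.
    by case: eqP p_odd => // <-.
  by rewrite mulnA mulnC expgM zp expg1n.
have zx : orb_act z (val x) = val x by apply: orb_fixP; apply: cycle_id.
have /= := valP K; rewrite inE leqNgt; apply/negP; rewrite negbK.
set b := repr (val (val x)).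
apply: (@p_rank_ge2 _ p _ (z ^ b)%g (y ^ b)%g) => //.
- exact: orb_act_fixP.
- exact: orb_act_fixP.
- by rewrite /commute -!conjMg (yz : (y * z = z * y)%g).
- by rewrite orderJ.
- by rewrite -conjXg yp conj1g.
- by rewrite cycleJ memJ_conjg.
Qed.

(** Orbits need not be free here, but the basis element of a point fixed by $y \ne 1$ passes through
    $C(\langle y\rangle)$, which is 0 as $n(\langle y\rangle) < 0$. *)
Lemma trivial_dim_lt0 (s t : gT) :
  (s ^+ p = 1)%g -> (t ^+ p = 1)%g -> commute s t ->
  (forall i j, (s ^+ i * t ^+ j = 1)%g -> (p %| i)%N && (p %| j)%N) ->
  (forall i j, (s ^+ i * t ^+ j != 1)%g -> n <[s ^+ i * t ^+ j]>%G < 0) ->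
  n 1%G < 0.
Proof.
move=> sp tp st ind dim.
have F1 : 1%G \in F.
  by have := cycle_rank_le1 1; rewrite (_ : <[1]>%G = 1%G) //; apply/val_inj/cycle1.
pose H : orb_ob F := exist _ 1%G F1.
apply: (@sphere_dim_lt0 _ F _ n C sphereC _ pcharFp p1_gt0 finC projC H s t).
- by rewrite (st : (s * t = t * s)%g).
- by rewrite norm1 inE.
- by rewrite norm1 inE.
- by rewrite prednK ?prime_gt0 // sp group1.
- by rewrite prednK ?prime_gt0 // tp group1.
move=> l K phi x i j; rewrite prednK ?prime_gt0 //.
set y := (s ^+ i * t ^+ j)%g => yx nij.
have y1 : y != 1%g by apply: contra nij => /eqP; apply: ind.
pose L : orb_ob F := exist _ <[y]>%G (cycle_rank_le1 y).
apply: (@rghom_delta_eq0 _ _ _ (C l) K H L phi x) => //=.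
- exact: sub1G.
- move=> a /cycleP[m ->]; elim: m => [|m IHm]; first by rewrite expg0 orb_act1.
  by rewrite expgSr orb_actM yx.
by apply: (sphere_dim_lt0_eq0 sphereC); apply: dim.
Qed.
End GroupSteps.

(** * Translations and transvections in $\operatorname{Qd}(p)$ *)

Section QdElements.
Variable p : nat.
Hypothesis p_pr : prime p.
Let k := 'F_p.
Implicit Types u v w : 'rV[k]_2.

Let pcharFp : p \in [pchar k]. Proof. exact: pchar_Fp. Qed.

(** Pairing with [perp v] is the alternating form with [v], which makes [shear v] the transvection
    along [v]. *)
Definition perp v : 'cV[k]_2 := \col_i (if i == 0 then - v 0 1 else v 0 0).
Definition shear v : 'M[k]_2 := 1%:M + perp v *m v.

Lemma mul_perp u v : u *m perp v = (u 0 1 * v 0 0 - u 0 0 * v 0 1)%:M.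
Proof.
rewrite [LHS]mx11_scalar; congr (_%:M); rewrite !mxE !big_ord_recl big_ord0 !mxE /=.
rewrite (_ : lift 0 0 = 1) ?addr0 ?mulrN 1?addrC //; exact: val_inj.
Qed.

Lemma mul_shear u v : u *m shear v = u + (u 0 1 * v 0 0 - u 0 0 * v 0 1) *: v.
Proof. by rewrite mulmxDr mulmx1 mulmxA mul_perp mul_scalar_mx. Qed.

Lemma det_mx22 (R : comNzRingType) (A : 'M[R]_2) :
  \det A = A 0 0 * A 1 1 - A 0 1 * A 1 0.
Proof.
have l00 : lift 0 0 = 1 :> 'I_2 by apply: val_inj.
have l10 : lift 1 0 = 0 :> 'I_2 by apply: val_inj.
rewrite (expand_det_row _ 0) big_ord_recl big_ord1 /cofactor !det_mx11 l00 !mxE.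
by rewrite l00 l10 expr0 mul1r expr1 mulN1r mulrN.
Qed.

Lemma det_shear v : \det (shear v) = 1.
Proof. by rewrite det_mx22 !mxE !big_ord1 !mxE /= ?mulr1n ?mulr0n; ring. Qed.

Definition qdv v : Qd p := sdpair1 ('MR (SL2_natural p))%gact v.

Lemma qdvD u v : qdv (u + v) = (qdv u * qdv v)%g.
Proof. by rewrite -FinRing.zmodMgE /qdv sdpair1_morphM ?inE. Qed.

Lemma qdv0 : qdv 0 = 1%g.
Proof. by apply: (mulgI (qdv 0)); rewrite -qdvD addr0 mulg1. Qed.

Lemma qdv_inj : injective qdv.
Proof. by move=> u v; apply: (injmP (injm_sdpair1 _)); rewrite inE. Qed.

Lemma qdvMn v n : qdv (v *+ n) = (qdv v ^+ n)%g.
Proof. by elim: n => [|n IHn]; rewrite ?qdv0 // mulrS qdvD IHn expgS. Qed.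

Lemma qdvN v : qdv (- v) = (qdv v)^-1%g.
Proof. by apply: (mulgI (qdv v)); rewrite -qdvD subrr qdv0 mulgV. Qed.

Lemma qdv_expp v : (qdv v ^+ p = 1)%g.
Proof. by rewrite -qdvMn -scaler_nat pchar_Fp_0 // scale0r qdv0. Qed.

Lemma qdv_commute u v : commute (qdv u) (qdv v).
Proof. by rewrite /commute -!qdvD addrC. Qed.

Lemma qdv_cycle (c : k) v : qdv (c *: v) \in <[qdv v]>%g.
Proof. by rewrite -(natr_Zp c) scaler_nat qdvMn mem_cycle. Qed.

(** [perp v *m v] has square zero because [v] pairs to 0 with [perp v], so the [n]-th power of
    [shear v] is linear in [n] and is 1 at $n = p$. *)
Lemma qd_shear v : exists t : Qd p, (t ^+ p = 1)%g /\
  forall u, (qdv u ^ t)%g = qdv (u *m shear v).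
Proof.
have shear_unit : shear v \is a GRing.unit by rewrite unitmxE det_shear unitr1.
pose A : {'GL_2[k]} := FinRing.Unit shear_unit.
have SL2_A : A \in SL2_group p by rewrite inE det_shear.
exists (sdpair2 ('MR (SL2_natural p))%gact A); split.
  rewrite -morphX //= (_ : (A ^+ p = 1)%g) ?morph1 //.
  apply: val_inj; rewrite /= FinRing.val_unitX /=.
  have Nn n : shear v ^+ n = 1%:M + n%:R *: (perp v *m v).
    elim: n => [|n IHn]; first by rewrite scale0r addr0.
    rewrite exprS IHn -[_ * _]/(_ *m _) /shear mulmxDl mul1mx mulmxDr mulmx1.
    rewrite -scalemxAr -mulmxA (mulmxA v) mul_perp mulrC subrr.
    rewrite raddf0 mul0mx mulmx0 scaler0 addr0 mulrS scalerDl scale1r.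
    by rewrite -addrA (addrC (_ *: _)).
  by rewrite Nn pchar_Fp_0 // scale0r addr0.
by move=> u; rewrite /qdv -sdpair_act ?inE ?det_shear //= mx_repr_actE.
Qed.

End QdElements.

(** * The contradiction in $\operatorname{Qd}(p)$ *)

Theorem proposition5p14 (p : nat) (p_prime : prime p) (p_odd : odd p)
    (n : {group Qd p} -> int)
    (n_conj : forall (H : {group Qd p}) (g : Qd p), n (H :^ g)%G = n H)
    (n_supp : forall H : {group Qd p},
       H \notin rank_le1_family (Qd p) p -> n H = -1)
    (n_triv : 0 <= n 1%G) :
  ~ exists C : chain_complex (rank_le1_family (Qd p) p) 'F_p,
      [/\ is_finite_complex C, is_projective_complex C
        & is_homology_sphere n C].
Proof.
case=> C [finC projC sphereC].
have dvdE i : (p %| i)%N = (i%:R == 0 :> 'F_p).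
  by rewrite (dvdn_pcharf (pchar_Fp p_prime)).
have center v : v != 0 -> n <[qdv v]>%G < 0.
  move=> v_neq0.
  (* [c] vanishes exactly on the line of [v]. A vector [w] off that line and the transvection [t]
     along [v] give the two generators modulo the centre $\langle v\rangle$. *)
  pose c (u : 'rV['F_p]_2) := u 0 1 * v 0 0 - u 0 0 * v 0 1.
  have [w cw] : exists w, c w != 0.
    have [v00|v00] := eqVneq (v 0 0) 0; last first.
      by exists (delta_mx 0 1); rewrite /c !mxE /= mul1r mul0r subr0.
    exists (delta_mx 0 0); rewrite /c !mxE /= mul1r mul0r sub0r oppr_eq0.
    apply: contraNneq v_neq0 => v01; apply/eqP/rowP=> j; rewrite mxE.
    case: j => [[|[|//]] lt_j]; [rewrite -[RHS]v00 | rewrite -[RHS]v01];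
      by congr (v _ _); apply: val_inj.
  have [t [tp tE]] := qd_shear p_prime v.
  have cv : c v = 0 by rewrite /c mulrC subrr.
  have tX u j : (qdv u ^ (t ^+ j))%g = qdv (u + (j%:R * c u) *: v).
    elim: j => [|j IHj]; first by rewrite conjg1 mul0r scale0r addr0.
    rewrite expgSr conjgM IHj tE mul_shear -/(c _); congr qdv.
    rewrite -addrA -scalerDl; congr (_ + _ *: _).
    by rewrite /c !mxE -natr1; ring.
  have tz : commute t (qdv v).
    by apply/commute_sym/commgP/conjg_fixP; rewrite tE mul_shear -/(c v) cv scale0r addr0.
  apply: (center_dim_lt0 p_prime p_odd finC projC sphereC (s := qdv w) (t := t)) => //.
  - by apply: contraNneq v_neq0 => v1; apply/eqP/(@qdv_inj p); rewrite v1 qdv0.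
  - exact: qdv_expp.
  - exact: qdv_expp.
  - exact: qdv_commute.
  - by rewrite /commg tE -qdvN -qdvD mul_shear addKr qdv_cycle.
  move=> i j; case/cycleP=> m st_m.
  (* So $t^j$ is a translation and commutes with [w], while conjugation by $t^j$ moves [w] by
     $j\,c(w)\,v$; hence $p$ divides $j$. *)
  have tjE : (t ^+ j)%g = qdv (v *+ m - w *+ i).
    by rewrite addrC qdvD qdvN !qdvMn -st_m mulKg.
  have pj : (p %| j)%N.
    have : (qdv w ^ (t ^+ j))%g = qdv w.
      by rewrite tjE; apply/conjg_fixP/commgP/qdv_commute.
    rewrite tX => /(@qdv_inj p)/eqP; rewrite -subr_eq0 addrC addKr scaler_eq0.
    by rewrite (negPf v_neq0) orbF mulf_eq0 (negPf cw) orbF dvdE.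
  rewrite pj andbT; have [q def_j] := dvdnP pj.
  (* Now $t^j = 1$, so $mv = iw$, and applying [c] gives $i\,c(w) = 0$. *)
  have : qdv (v *+ m - w *+ i) = qdv 0.
    by rewrite -tjE qdv0 def_j mulnC expgM tp expg1n.
  move/(@qdv_inj p)/eqP; rewrite subr_eq0 => /eqP vw.
  have : c (w *+ i) = 0 by rewrite -vw /c -!scaler_nat !mxE; ring.
  rewrite /c -!scaler_nat !mxE => c0; rewrite dvdE.
  have : i%:R * c w = 0 by rewrite -[RHS]c0 /c; ring.
  by move/eqP; rewrite mulf_eq0 (negPf cw) orbF.
suff : n 1%G < 0 by rewrite ltNge n_triv.
(* The standard basis generates $V$, and [center] covers each nontrivial element of $V$. *)
pose e0 : 'rV['F_p]_2 := delta_mx 0 0; pose e1 : 'rV['F_p]_2 := delta_mx 0 1.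
have eE i j : (qdv e0 ^+ i * qdv e1 ^+ j)%g = qdv (e0 *+ i + e1 *+ j).
  by rewrite qdvD !qdvMn.
apply: (trivial_dim_lt0 p_prime finC projC sphereC (s := qdv e0) (t := qdv e1)).
- exact: qdv_expp.
- exact: qdv_expp.
- exact: qdv_commute.
- move=> i j; rewrite eE -(qdv0 p) => /(@qdv_inj p)/rowP e_ij.
  have := e_ij 0; have := e_ij 1; rewrite -!scaler_nat !mxE /= !mulr0 !mulr1.
  by rewrite add0r addr0 !dvdE => -> ->; rewrite eqxx.
move=> i j; rewrite eE => e_neq1; apply: center.
by apply: contraNneq e_neq1 => ->; rewrite qdv0.
Qed.
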